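(* Let $G\in\mathcal G^3_2$ and suppose that no connected component of $G$ has exactly $5$ vertices. Then $\lambda(G)\ge v(G)/4$.
   Context: All graphs are finite and simple. For integers $1\le r\le s$, $\mathcal G^s_r$ denotes the set of graphs in which every vertex has degree at least $r$ and at most $s$. $v(G)$ is the number of vertices of $G$. $\lambda(G)$ denotes the maximum number of pairwise vertex-disjoint subgraphs of $G$ each of which is a path with exactly two edges. *)

(* Defs.v *)
From mathcomp Require Import all_boot.
Set Implicit Arguments. Unset Strict Implicit. Unset Printing Implicit Defensive.

Definition simple_graph (T : finType) (e : rel T) : Prop :=
  symmetric e /\ irreflexive e.

Definition deg (T : finType) (e : rel T) (x : T) : nat := #|[set y | e x y]|.

Definition in_Grs (T : finType) (e : rel T) (r s : nat) : Prop :=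
  forall x, r <= deg e x <= s.

Definition component (T : finType) (e : rel T) (x : T) : {set T} :=
  [set y | connect e x y].

Definition is_P3 (T : finType) (e : rel T) (S : {set T}) : bool :=
  [exists a, exists b, exists c,
     [&& a != b, b != c, a != c, e a b, e b c & S == [set a; b; c]]].

Definition P3_packing (T : finType) (e : rel T) (F : {set {set T}}) : bool :=
  [forall S in F, is_P3 e S] && trivIset F.

Definition lambda (T : finType) (e : rel T) : nat :=
  \max_(F : {set {set T}} | P3_packing e F) #|F|.

(* Main.v *)
Require Import Defs.
From mathcomp Require Import all_boot zify.
(** Count every component with five vertices as an allowance of one and argue by induction
    on the numbers of vertices and edges: [|A| <= 4 f + #(closed 5-sets)].  In a minimal
    counterexample, an edge between two vertices of degree 3 must be a bridge cutting off
    exactly five vertices (otherwise delete it); three consecutive vertices of degree 2 can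
    be contracted to an edge, except on a pendant 4- or 5-cycle; and no vertex of degree 3
    has three neighbours of degree 2 all of whose neighbours have degree 3 (otherwise remove
    this claw, together with a 5-vertex component if that creates one).  Call a 5-set with a
    single outgoing edge [t w] pendant.  Outside the pendant sets, every vertex has degree 3
    or a neighbour of degree 3; a vertex of degree 2 shared by two such centres is taken
    away from one of them so that every centre loses at most one neighbour, and each centre
    still has a path of its own.  With one path in each pendant set minus [t], the paths
    number a quarter of the vertices, since closed neighbourhoods of centres and the sets
    [S :\ t] have at most four elements and cover the graph. *)

Set Implicit Arguments. Unset Strict Implicit. Unset Printing Implicit Defensive.

(** * Packings of 2-edge paths *)

Section Packings.
Variable T : finType.
Implicit Types (e : rel T) (A B Q S : {set T}) (F : {set {set T}}).

(** A form of [lambda] relative to a region [Q] and stated as a lower bound, so that packings of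
    disjoint regions add up. *)
Definition packs e Q f :=
  exists F, [/\ P3_packing e F, cover F \subset Q & f <= #|F|].

Lemma P3_card e S : is_P3 e S -> #|S| = 3.
Proof.
move=> /existsP[a /existsP[b /existsP[c /and5P[ab bc ac _ /andP[_ /eqP->]]]]].
by rewrite setUC cardsU1 cards2 !inE ab negb_or eq_sym ac eq_sym bc.
Qed.

Lemma packs0 e Q : packs e Q 0.
Proof.
exists set0; split; rewrite ?cards0 ?/cover ?big_set0 ?sub0set //.
rewrite /P3_packing; apply/andP; split; last by apply/trivIsetP => ? ?; rewrite inE.
by apply/forall_inP => ?; rewrite inE.
Qed.

Lemma packs_le e Q f f' : f' <= f -> packs e Q f -> packs e Q f'.
Proof. by move=> le [F [? ? ?]]; exists F; split=> //; apply: leq_trans le _. Qed.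

Lemma packs_subset e Q Q' f : Q \subset Q' -> packs e Q f -> packs e Q' f.
Proof. by move=> le [F [? ? ?]]; exists F; split=> //; apply: subset_trans le. Qed.

Lemma packs_subrel e e' Q f :
  (forall x y, x \in Q -> y \in Q -> e x y -> e' x y) -> packs e Q f -> packs e' Q f.
Proof.
move=> le [F [/andP[/forall_inP FP tF] FQ ?]]; exists F; split=> //.
apply/andP; split=> //; apply/forall_inP => S SF.
have /subsetP SQ : S \subset Q by apply: subset_trans FQ; apply: bigcup_sup.
move: (FP _ SF) => /existsP[a /existsP[b /existsP[c /and5P[ab bc ac eab /andP[ebc /eqP eS]]]]].
apply/existsP; exists a; apply/existsP; exists b; apply/existsP; exists c.
by rewrite ab bc ac eS eqxx !le //; apply: SQ; rewrite eS !inE eqxx ?orbT.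
Qed.

Lemma packsU e Q1 Q2 f1 f2 : [disjoint Q1 & Q2] ->
  packs e Q1 f1 -> packs e Q2 f2 -> packs e (Q1 :|: Q2) (f1 + f2).
Proof.
move=> dQ [F1 [/andP[/forall_inP P1 t1] c1 n1]] [F2 [/andP[/forall_inP P2 t2] c2 n2]].
have dc : [disjoint cover F1 & cover F2].
  by apply: disjointWl c1 _; apply: disjointWr c2 _.
exists (F1 :|: F2); split.
- apply/andP; split; last by apply: trivIsetU => //; rewrite disjoint_sym.
  by apply/forall_inP => S; rewrite inE => /orP[/P1|/P2].
- by rewrite /cover bigcup_setU setUSS.
- rewrite cardsU disjoint_setI0 ?cards0 ?subn0; first exact: leq_add.
  (* Disjoint covers make the families disjoint because a path is nonempty. *)
  apply/pred0P => S /=; apply/negP => /andP[S1 S2].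
  have [s sS] : exists s, s \in S.
    by apply/set0Pn; rewrite -card_gt0 (P3_card (P1 _ S1)).
  by have /pred0P/(_ s)/negP[] := dc; apply/andP; split; apply/bigcupP; exists S.
Qed.

Lemma packs_P3 e Q a b c : a != c -> e b a -> e b c -> symmetric e -> irreflexive e ->
  a \in Q -> b \in Q -> c \in Q -> packs e Q 1.
Proof.
move=> ac eba ebc sy ir aQ bQ cQ; exists [set [set a; b; c]]; split.
- apply/andP; split.
    apply/forall_inP => S; rewrite inE => /eqP->.
    apply/existsP; exists a; apply/existsP; exists b; apply/existsP; exists c.
    rewrite ac sy eba ebc eqxx !andbT.
    by apply/andP; split; apply/eqP => E; move: eba ebc; rewrite ?E -?E ir.
  by apply/trivIsetP => S S'; rewrite !inE => /eqP-> /eqP->; rewrite eqxx.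
- by rewrite /cover big_set1; apply/subsetP => x; rewrite !inE => /orP[/orP[]|] /eqP->.
- by rewrite cards1.
Qed.

Lemma packs_bigcup e (I : finType) (P : {set I}) (D : I -> {set T}) :
  (forall i, i \in P -> packs e (D i) 1) ->
  (forall i j, i \in P -> j \in P -> i != j -> [disjoint D i & D j]) ->
  packs e (\bigcup_(i in P) D i) #|P|.
Proof.
have [n le] := ubnP #|P|; elim: n P le => // n IH P le; have [->|[i iP]] := set_0Vmem P.
  by rewrite cards0; move=> *; apply: packs0.
move=> DP dD; rewrite (big_setD1 i) //= (cardsD1 i) iP.
apply: packsU; last 1 first.
- apply: IH; first by rewrite (cardsD1 i) iP in le.
    by move=> j /setD1P[_ ?]; apply: DP.
  by move=> j k /setD1P[_ ?] /setD1P[_ ?]; apply: dD.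
- rewrite -setI_eq0; apply/eqP/setP => x; rewrite !inE.
  apply/negP => /andP[xi /bigcupP[j /setD1P[ji jP] xj]].
  rewrite eq_sym in ji; by have /pred0P/(_ x)/negP[] := dD _ _ iP jP ji; apply/andP.
- exact: DP.
Qed.

Lemma packs_lambda e Q f : packs e Q f -> f <= lambda e.
Proof. by move=> [F [? _ le]]; apply: leq_trans le _; apply: leq_bigmax_cond. Qed.

End Packings.

(** * Graphs with degrees 2 and 3 on a vertex set [A] *)

Section Graphs.
Variable T : finType.
Implicit Types (e : rel T) (A B Q S : {set T}).

Definition nbrs e x := [set y | e x y].

(** The vertex set is a subset of a fixed type, so reductions change only [A] and [e]. Edges stay
    inside [A], so [deg] is the degree in the graph. *)
Definition graph A e :=
  [/\ symmetric e, irreflexive e, (forall x y, e x y -> x \in A)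
    & forall x, x \in A -> 2 <= deg e x <= 3].

Definition closed_set e S := [forall x in S, forall y, e x y ==> (y \in S)].

Lemma closed_setP e S :
  reflect (forall x y, x \in S -> e x y -> y \in S) (closed_set e S).
Proof.
apply: (iffP forall_inP) => [cl x y xS | cl x xS].
  by move/implyP: (forallP (cl _ xS) y); apply.
by apply/forallP => y; apply/implyP; apply: cl.
Qed.

(** In a graph with degrees at least 2 these are the components with five vertices: five vertices
    cannot split into two closed parts of at least three each. *)
Definition closed5 A e := [set S : {set T} | [&& S \subset A, #|S| == 5 & closed_set e S]].

(** Neighbourhoods are given by boolean equations, so that adjacency in small configurations is
    settled by rewriting. *)
Lemma deg2P e x a : deg e x = 2 -> e x a ->
  exists2 b, b != a & forall y, e x y = (y == a) || (y == b).
Proof.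
rewrite /deg => /eqP/cards2P[u [v [uv E]]] xa.
have N y : e x y = (y == u) || (y == v) by move/setP/(_ y): E; rewrite !inE.
by move: xa; rewrite N => /orP[]/eqP->; [exists v|exists u] => // [|y];
  rewrite ?N 1?eq_sym // orbC.
Qed.

Lemma card3P S : #|S| = 3 -> exists a b c, [/\ a != b, b != c, a != c & S = [set a; b; c]].
Proof.
move=> S3; have /card_gt0P[a aS] : 0 < #|S| by rewrite S3.
have /eqP/cards2P[b [c [bc E]]] : #|S :\ a| = 2 by move: (cardsD1 a S); rewrite aS S3; lia.
exists a, b, c; have : b \in S :\ a /\ c \in S :\ a by rewrite E !inE !eqxx orbT.
rewrite !inE => -[/andP[ba _] /andP[ca _]]; split=> //; try by rewrite eq_sym.
by rewrite -setUA -E setD1K.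
Qed.

Lemma deg3P e x a : deg e x = 3 -> e x a ->
  exists b c, [/\ b != a, c != a, b != c & forall y, e x y = [|| y == a, y == b | y == c]].
Proof.
rewrite /deg => /card3P[u [v [w [uv vw uw E]]]] xa.
have N y : e x y = [|| y == u, y == v | y == w].
  by move/setP/(_ y): E; rewrite !inE orbA.
move: xa; rewrite N => /or3P[]/eqP->; [exists v, w|exists u,w|exists u,v]; split=> //;
  try (by rewrite eq_sym); move=> y; rewrite N; do !case: (y == _) => //.
Qed.

Lemma deg3P2 e x a b : deg e x = 3 -> e x a -> e x b -> a != b ->
  exists c, [/\ c != a, c != b & forall y, e x y = [|| y == a, y == b | y == c]].
Proof.
move=> d xa xb ab; have [u [v [ua va uv N]]] := deg3P d xa.
move: xb; rewrite N [b == a]eq_sym (negbTE ab) /= => /orP[]/eqP E; subst b; [exists v|exists u];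
  split=> //; try (by rewrite eq_sym).
by move=> y; rewrite N [(y == u) || _]orbC.
Qed.

Lemma cards_seq_le (s : seq T) : #|[set:: s]| <= size s.
Proof. by rewrite cardsE card_size. Qed.

Lemma cards_seq_uniq (s : seq T) : uniq s -> #|[set:: s]| = size s.
Proof. by rewrite cardsE => /card_uniqP. Qed.

Lemma card_nbrsI e x S : #|nbrs e x :&: S| = \sum_(y in S) e x y.
Proof.
rewrite -sum1_card big_mkcond /= [RHS]big_mkcond /=; apply: eq_bigr => y _.
by rewrite !inE andbC; case: (y \in S); case: (e x y).
Qed.

(** Any two edges on three vertices share a vertex, the middle of the path. *)
Lemma P3_of_edges e S a b c : symmetric e -> irreflexive e ->
  a != b -> b != c -> a != c -> a \in S -> b \in S -> c \in S ->
  2 <= e a b + e b c + e a c -> packs e S 1.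
Proof.
move=> sy ir ab bc ac aS bS cS.
case: (boolP (e a b)) (boolP (e b c)) (boolP (e a c)) => [Hab|_] [Hbc|_] [Hac|_] //= _;
 solve [apply: (@packs_P3 _ e _ a b c) => //; rewrite sy //
 | apply: (@packs_P3 _ e _ b a c) => //; rewrite sy //
 | apply: (@packs_P3 _ e _ a c b) => //; rewrite sy //].
Qed.

(* Counting the edges between [S :\ t :\ t'] and the rest: at most three of them
   leave this triple, whose degrees sum to at least six, so it spans two edges. *)
Lemma packs_core e S t t' : symmetric e -> irreflexive e -> #|S| = 5 ->
  t \in S -> t' \in S -> e t t' ->
  (forall x, x \in S -> x != t -> 2 <= #|nbrs e x :&: S|) ->
  #|nbrs e t :&: S| <= 2 -> #|nbrs e t' :&: S| <= 3 ->
  packs e (S :\ t :\ t') 1.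
Proof.
move=> sy ir S5 tS t'S tt' dS dt dt'.
have nt : t' != t by apply/eqP => E; rewrite E ir in tt'.
have t'St : t' \in S :\ t by rewrite !inE nt.
have := cardsD1 t S; have := cardsD1 t' (S :\ t).
rewrite tS t'St S5 => c1 c2.
have /card3P[a [b [c [ab bc ac E]]]] : #|S :\ t :\ t'| = 3 by lia.
have inS x : x \in [set a; b; c] -> [/\ x \in S, x != t & x != t'].
  by rewrite -E !inE => /and3P[].
have [aS at_ at'] := inS a ltac:(rewrite !inE eqxx ?orbT //).
have [bS bt bt'] := inS b ltac:(rewrite !inE eqxx ?orbT //).
have [cS ct ct'] := inS c ltac:(rewrite !inE eqxx ?orbT //).
have sum x : #|nbrs e x :&: S| = e x t + (e x t' + (e x a + (e x b + e x c))).
  rewrite card_nbrsI (big_setD1 t) //= (big_setD1 t') //= E.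
  rewrite -setUA big_setU1 ?big_setU1 ?big_set1 //= !inE ?negb_or ?ab ?ac ?bc //.
have da := dS _ aS at_; have db := dS _ bS bt; have dc := dS _ cS ct.
move: dt dt' da db dc; rewrite !sum !ir (sy a t) (sy b t) (sy c t) (sy a t') (sy b t') (sy c t').
rewrite (sy t' t) (sy b a) (sy c a) (sy c b) tt' => dt dt' da db dc.
apply: (@P3_of_edges e _ a b c) => //; rewrite ?E ?inE ?eqxx ?orbT //.
clear -dt dt' da db dc.
move: (nat_of_bool (e a b)) (nat_of_bool (e b c)) (nat_of_bool (e a c)) dt dt' da db dc => p q r.
move: (nat_of_bool (e t a)) (nat_of_bool (e t b)) (nat_of_bool (e t c)) => ta tb tc.
move: (nat_of_bool (e t' a)) (nat_of_bool (e t' b)) (nat_of_bool (e t' c)) => sa sb sc.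
rewrite /=; lia.
Qed.

(** * Vertex deletion and closed sets *)

Definition avoid e Q : rel T := fun x y => [&& e x y, x \notin Q & y \notin Q].

Section ClosedSets.
Variables (A : {set T}) (e : rel T).
Hypothesis gr : graph A e.

Lemma graph_nbr2 x : x \in A -> exists a b, [/\ a != b, e x a & e x b].
Proof.
case: gr => _ _ _ d /d /andP[/card_gt1P[a [b [aN bN ab]]] _].
by exists a, b; move: aN bN; rewrite !inE.
Qed.

Lemma closed_P3 S : S \subset A -> S != set0 -> closed_set e S -> packs e S 1.
Proof.
move=> /subsetP SA /set0Pn[x xS] /closed_setP cl.
have [a [b [ab xa xb]]] := graph_nbr2 (SA _ xS).
by case: gr => sy ir _ _; apply: (@packs_P3 _ e _ a x b) => //; apply: (cl x).
Qed.

Lemma closed_ge3 S : S \subset A -> S != set0 -> closed_set e S -> 3 <= #|S|.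
Proof.
move=> SA S0 cl; have [F [/andP[/forall_inP FP _] /subsetP cF]] := closed_P3 SA S0 cl.
move=> /card_gt0P[P PF]; rewrite -(P3_card (FP _ PF)); apply/subset_leq_card/subsetP => x xP.
by apply: cF; apply/bigcupP; exists P.
Qed.

(** The path avoids both ends of an edge at [t], leaving [t] and [t'] free for a path that enters
    from outside. *)
Lemma closed5_core S t t' : S \in closed5 A e -> t \in S -> deg e t <= 2 -> e t t' ->
  packs e (S :\ t :\ t') 1.
Proof.
case: gr => sy ir _ dA; rewrite inE => /and3P[/subsetP SA /eqP S5 /closed_setP cl] tS dt tt'.
have nS x : x \in S -> nbrs e x :&: S = nbrs e x.
  by move=> xS; apply/setIidPl/subsetP => y; rewrite inE; apply: cl.
have t'S := cl _ _ tS tt'.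
apply: packs_core => // [x xS _||]; rewrite nS //.
  by have /andP[] := dA x (SA x xS).
by have /andP[] := dA t' (SA t' t'S).
Qed.

Lemma closed_setI S S' : closed_set e S -> closed_set e S' -> closed_set e (S :&: S').
Proof.
move=> /closed_setP c1 /closed_setP c2; apply/closed_setP => x y /setIP[x1 x2] xy.
by rewrite inE (c1 x) // (c2 x).
Qed.

Lemma closed_setD S S' : closed_set e S -> closed_set e S' -> closed_set e (S :\: S').
Proof.
case: gr => sy _ _ _.
move=> /closed_setP c1 /closed_setP c2; apply/closed_setP => x y /setDP[x1 x2] xy.
rewrite inE (c1 x) // andbT; apply: contra x2 => /c2; apply; by rewrite sy.
Qed.

(** If distinct sets met, their intersection and difference would be nonempty closed sets, giving at
    least 3 + 3 vertices in a set of five. *)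
Lemma closed5_disjoint S S' : S \in closed5 A e -> S' \in closed5 A e -> S != S' ->
  [disjoint S & S'].
Proof.
rewrite !inE => /and3P[SA /eqP S5 cS] /and3P[SA' /eqP S5' cS'] ne.
rewrite -setI_eq0; apply: contraNT ne => I0.
have I3 := closed_ge3 (subset_trans (subsetIl _ _) SA) I0 (closed_setI cS cS').
have [D0|D0] := eqVneq (S :\: S') set0.
  by rewrite eqEcard S5 S5' leqnn andbT -setD_eq0 D0.
have := closed_ge3 (subset_trans (subsetDl _ _) SA) D0 (closed_setD cS cS').
have := cardsID S' S; lia.
Qed.

(** Double counting of incidences: closed 5-sets are disjoint, so each vertex of the hitting set [X]
    accounts for at most one. *)
Lemma card_closed5 (X : {set T}) : (forall S, S \in closed5 A e -> exists2 x, x \in S & x \in X) ->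
  #|closed5 A e| <= #|X|.
Proof.
move=> hit; rewrite -!sum1_card.
apply: (@leq_trans (\sum_(S in closed5 A e) \sum_(x in X) (x \in S : nat))).
  apply: leq_sum => S /hit[x xS xX].
  by rewrite (big_setD1 x) //= xS leq_addr.
rewrite exchange_big /=; apply: leq_sum => x _.
rewrite -[leqLHS]big_mkcondr /= sum1_card; apply/card_le1_eqP => S S'.
rewrite !unfold_in /= => /andP[F1 x1] /andP[F2 x2].
apply/eqP/contraT => ne; have /pred0P/(_ x)/negP[] := closed5_disjoint F2 F1 ne.
by apply/andP.
Qed.
(** An outside vertex next to [Q] has degree 3 and loses exactly one neighbour, so its degree drops
    to 2. *)
Lemma avoid_graph Q :
  (forall q x, q \in Q -> x \notin Q -> e q x ->
     deg e x = 3 /\ forall q', q' \in Q -> e q' x -> q' = q) ->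
  graph (A :\: Q) (avoid e Q).
Proof.
move=> touch; case: gr => sy ir inA degA.
split.
- by move=> x y; rewrite /avoid sy [(y \notin Q) && _]andbC.
- by move=> x; rewrite /avoid ir.
- by move=> x y /and3P[/inA xA xQ _]; rewrite inE xQ.
- move=> x /setDP[xA xQ]; have dx := degA _ xA.
  have E : deg (avoid e Q) x = #|nbrs e x :\: Q|.
    by apply: eq_card => y; rewrite !inE /avoid xQ andbC.
  rewrite E; have := cardsID Q (nbrs e x); rewrite -[#|nbrs e x|]/(deg e x).
  have [I0|/set0Pn[q /setIP[xq qQ]]] := eqVneq (nbrs e x :&: Q) set0.
    by rewrite I0 cards0; lia.
  rewrite inE in xq.
  have [d3 uni] := touch q x qQ xQ ltac:(by rewrite sy).
  have -> : nbrs e x :&: Q = [set q].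
    apply/setP => y; rewrite !inE; apply/andP/eqP => [[xy yQ]|-> //].
    by apply: uni => //; rewrite sy.
  by rewrite cards1; lia.
Qed.

End ClosedSets.
End Graphs.

(** * Representatives of pairs *)

(* If at most one of the sets is a singleton, representing it first (or an arbitrary set
   if there is none) shrinks at most one other set, so the hypotheses are preserved. *)
Lemma sdr_of_pairs (T : finType) (N : T -> {set T}) (M : {set T}) :
  (forall m, m \in M -> N m != set0) ->
  (forall v, #|[set m in M | v \in N m]| <= 2) ->
  #|[set m in M | #|N m| == 1]| <= 1 ->
  exists g : T -> T, {in M, forall m, g m \in N m} /\ {in M &, injective g}.
Proof.
have [n le] := ubnP #|M|; elim: n M N le => // n IH M N le N0 N2 N1.
have [->|[m mM]] := set_0Vmem M.
  by exists id; split=> [x|x y]; rewrite inE.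
have [m0 m0M single] : exists2 m0, m0 \in M &
    forall m', m' \in M -> #|N m'| == 1 -> m' = m0.
  have [E|[m0]] := set_0Vmem [set m in M | #|N m| == 1].
    by exists m => // m' m'M m'1; move/setP/(_ m'): E; rewrite !inE m'M m'1.
  rewrite inE => /andP[m0M m01]; exists m0 => // m' m'M m'1.
  by move/card_le1_eqP: N1; apply; rewrite inE ?m'M ?m0M.
have /set0Pn[v vN] := N0 _ m0M.
have [|m'|u||g [gN gi]] := IH (M :\ m0) (fun m => N m :\ v).
- by rewrite (cardsD1 m0) m0M in le.
- move=> /setD1P[nm m'M]; rewrite -card_gt0.
  have : 0 < #|N m'| by rewrite card_gt0 N0.
  have : #|N m'| != 1 by apply: contraNneq nm => /eqP/single->.
  have := cardsD1 v (N m'); have := leq_b1 (v \in N m'); clear; lia.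
- apply: leq_trans (N2 u); apply/subset_leq_card/subsetP => x.
  by rewrite !inE => /andP[/andP[_ ->] /andP[_ ->]].
- have := N2 v; rewrite (cardsD1 m0) inE m0M vN ltnS; apply: leq_trans.
  apply/subset_leq_card/subsetP => x; rewrite !inE => /andP[/andP[xm xM] /eqP x1].
  rewrite xm xM /=; apply: contraNT xm => vx; apply/eqP/single => //.
  by have := cardsD1 v (N x); rewrite (negbTE vx) x1 => ->.
exists (fun m' => if m' == m0 then v else g m'); split=> [x xM|x y xM yM].
  case: eqVneq => [->//|xm]; have : g x \in N x :\ v by apply: gN; rewrite !inE xm.
  by rewrite inE => /andP[].
have gv z : z \in M -> z != m0 -> g z != v.
  move=> zM zm; have : g z \in N z :\ v by apply: gN; rewrite !inE zm.
  by rewrite !inE => /andP[].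
case: (eqVneq x m0) => [->|xm]; case: (eqVneq y m0) => [->|ym] //.
- by move=> E; have := gv y yM ym; rewrite E eqxx.
- by move=> E; have := gv x xM xm; rewrite E eqxx.
- by apply: gi; rewrite !inE ?xm ?ym.
Qed.

Lemma card_bigcup_le (I T : finType) (P : {set I}) (D : I -> {set T}) k :
  (forall i, i \in P -> #|D i| <= k) -> #|\bigcup_(i in P) D i| <= k * #|P|.
Proof.
move=> le; rewrite mulnC -sum_nat_const; apply: leq_trans (leq_sum _ le).
by elim/big_ind2: _ => [|x a y b xa yb|//]; rewrite ?cards0 //;
  apply: leq_trans (leq_card_setU _ _).1 _; apply: leq_add.
Qed.

(** * Reductions in a minimal counterexample *)

Section Minimal.
Variable T : finType.
Implicit Types (e : rel T) (A B Q S X : {set T}).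

Definition edges e := [set p : T * T | e p.1 p.2].

Definition well_packed A e :=
  exists2 f, packs e A f & #|A| <= 4 * f + #|closed5 A e|.

(** Minimality is lexicographic: fewer vertices with any relation, or the same vertices with fewer
    edges. Closed 5-sets can be excluded because the final induction splits them off beforehand. *)
Record minimal_counterexample A e : Prop := {
  mc_graph : graph A e;
  mc_fewer_vertices : forall A' e', graph A' e' -> #|A'| < #|A| -> well_packed A' e';
  mc_fewer_edges : forall e', graph A e' -> #|edges e'| < #|edges e| -> well_packed A e';
  mc_no_closed5 : forall S, S \subset A -> #|S| = 5 -> closed_set e S -> False;
  mc_packs : forall f, packs e A f -> 4 * f < #|A| }.

Variables (A : {set T}) (e : rel T).
Hypothesis mc : minimal_counterexample A e.

Let gr : graph A e := mc_graph mc.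
Let IHA := mc_fewer_vertices mc.
Let no5 := mc_no_closed5 mc.
Let bad := mc_packs mc.
Let sy : symmetric e. Proof. by case: gr. Qed.
Let ir : irreflexive e. Proof. by case: gr. Qed.
Let inA x y : e x y -> x \in A. Proof. by case: gr => _ _ h _; apply: h. Qed.
Let inA' x y : e x y -> y \in A. Proof. by rewrite sy; apply: inA. Qed.
Let degA x : x \in A -> 2 <= deg e x <= 3. Proof. by case: gr => _ _ _ h; apply: h. Qed.
Let neq x y : e x y -> x != y. Proof. by apply: contraTneq => ->; rewrite ir. Qed.

Lemma min_deg23 x y : e x y -> {deg e x = 2} + {deg e x = 3}.
Proof.
move=> xy; case: (eqVneq (deg e x) 2); first by left.
by right; have := degA (inA xy); lia.
Qed.

(** Restricts the edges leaving [Q] without asserting that there is one; [pendant] adds its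
    presence. *)
Definition only_edge (Q : {set T}) x y :=
  forall x' y', x' \in Q -> y' \notin Q -> e x' y' -> x' = x /\ y' = y.

(** A closed 5-set that appears when [Q] is deleted has a neighbour in [Q]; otherwise it would be
    closed in the original graph. *)
Lemma closed5_avoid Q S : S \in closed5 (A :\: Q) (avoid e Q) ->
  exists q x, [/\ q \in Q, x \in S, x \notin Q & e q x].
Proof.
rewrite inE => /and3P[/subsetP SA /eqP S5 /closed_setP cS].
have SQ x : x \in S -> x \in A /\ x \notin Q by move/SA/setDP.
case: (boolP [exists q in Q, exists x in S, e q x]).
  move=> /exists_inP[q qQ /exists_inP[x xS qx]]; exists q, x; split=> //.
  by case: (SQ x xS).
move/exists_inP=> no; exfalso; apply: (no5 _ S5); first by apply/subsetP => x /SQ[].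
apply/closed_setP => x y xS xy; apply: (cS x) => //.
rewrite /avoid xy (SQ x xS).2 /=; apply/negP => yQ; apply: no; exists y => //.
by apply/exists_inP; exists x; rewrite // sy.
Qed.

Lemma card_setDA Q : Q \subset A -> #|A :\: Q| + #|Q| = #|A|.
Proof. by move=> QA; have := cardsID Q A; rewrite (setIidPr QA) addnC. Qed.

(** The rest packs [f'] paths with [#|A :\: Q| <= 4 * f' + k], where [k] counts the new closed
    5-sets. Since [f + f'] paths are too few for [A], the [f] paths are too few for [#|Q| + k]. *)
Lemma min_remove_closed5 Q f : Q \subset A -> Q != set0 -> packs e Q f ->
  (forall q x, q \in Q -> x \notin Q -> e q x ->
     deg e x = 3 /\ forall q', q' \in Q -> e q' x -> q' = q) ->
  4 * f < #|Q| + #|closed5 (A :\: Q) (avoid e Q)|.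
Proof.
move=> QA Q0 pQ touch.
have gr' := avoid_graph gr touch; have QA' := card_setDA QA.
have Q1 : 0 < #|Q| by rewrite card_gt0.
have [|f' pf' le] := IHA gr'; first by lia.
have pA : packs e A (f + f').
  rewrite -(setID A Q) (setIidPr QA); apply: packsU => //.
    by rewrite -setI_eq0 setIDA setDIl setDv set0I.
  by apply: packs_subrel pf' => x y _ _ /and3P[].
by have := bad pA; lia.
Qed.

Lemma min_closed_packs Q f : Q \subset A -> Q != set0 -> closed_set e Q -> packs e Q f ->
  4 * f < #|Q|.
Proof.
move=> QA Q0 /closed_setP cl pQ.
have := min_remove_closed5 QA Q0 pQ.
have -> : closed5 (A :\: Q) (avoid e Q) = set0.
  apply/setP => S; rewrite [RHS]inE; apply/negP => /closed5_avoid[q [x [qQ _ xQ qx]]].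
  by case/negP: xQ; apply: cl qx.
rewrite cards0 addn0; apply=> q x qQ xQ qx; case/negP: xQ; exact: cl qx.
Qed.

(** Each closed 5-set created by the removal contains an outer neighbour of [Q], hence meets [X]. *)
Lemma min_remove Q X f : Q \subset A -> Q != set0 -> packs e Q f ->
  (forall q x, q \in Q -> x \notin Q -> e q x ->
     [/\ x \in X, deg e x = 3 & forall q', q' \in Q -> e q' x -> q' = q]) ->
  4 * f < #|Q| + #|X|.
Proof.
move=> QA Q0 pQ touch.
have touch' q x : q \in Q -> x \notin Q -> e q x ->
     deg e x = 3 /\ forall q', q' \in Q -> e q' x -> q' = q.
  by move=> qQ xQ qx; case: (touch q x qQ xQ qx).
apply: leq_trans (min_remove_closed5 QA Q0 pQ touch') _; rewrite leq_add2l.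
apply: (card_closed5 (avoid_graph gr touch')) => S /closed5_avoid[q [x [qQ xS xQ qx]]].
by exists x => //; case: (touch q x qQ xQ qx).
Qed.

Lemma min_closed_gt4 Q : Q \subset A -> Q != set0 -> closed_set e Q -> 5 < #|Q|.
Proof.
move=> QA Q0 cl; have := min_closed_packs QA Q0 cl (closed_P3 gr QA Q0 cl).
by case: (eqVneq #|Q| 5) => [/no5|]; [case|lia].
Qed.

Definition link Q u v : rel T := fun x y =>
  [|| avoid e Q x y, (x == u) && (y == v) | (x == v) && (y == u)].

(* A path [a - u - v] through the new edge is rerouted to [a - u - x], and [v] helps to
   cover the rest of [Q]; so the old graph packs one path more than the new one. *)
Lemma min_link Q x x' u v : #|Q| <= 4 -> Q \subset A -> x \in Q -> x' \in Q ->
  u \notin Q -> v \notin Q -> u != v -> ~~ e u v -> e x u -> e x' v ->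
  (forall a b, a \in Q -> b \notin Q -> e a b -> (a = x /\ b = u) \/ (a = x' /\ b = v)) ->
  packs e Q 1 -> packs e (v |: Q :\ x) 1 -> packs e (u |: Q :\ x') 1 ->
  [/\ 4 <= #|Q|, graph (A :\: Q) (link Q u v), deg (link Q u v) u = deg e u
    & exists S, [/\ S \in closed5 (A :\: Q) (link Q u v), u \in S & v \in S]].
Proof.
move=> Q4 QA xQ x'Q uQ vQ uv nuv xu x'v out pQ pv pu.
(* An end of the new edge trades its only neighbour in [Q] for the other end, so its degree is
   unchanged. *)
have degL (Q1 : {set T}) a b c : c \in Q -> e a c -> b \notin Q -> ~~ e a b ->
    (forall q, q \in Q -> e a q -> q = c) -> #|b |: (nbrs e a :\: Q)| = deg e a.
  move=> cQ ac bQ nab uni; rewrite cardsU1 !inE (negbTE nab) andbF add1n.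
  have := cardsID Q (nbrs e a); rewrite -[#|nbrs e a|]/(deg e a).
  have -> : nbrs e a :&: Q = [set c].
    apply/setP => y; rewrite !inE; apply/andP/eqP => [[ay yQ]|-> //].
    exact: uni.
  by rewrite cards1.
have degE y : y \in A :\: Q -> deg (link Q u v) y = deg e y.
  move=> /setDP[yA yQ].
  have [->|yu] := eqVneq y u.
    rewrite -(degL Q u v x) //; last 2 first.
    - by rewrite sy.
    - move=> q qQ uq; have [[]|[_ E]] // := out q u qQ uQ ltac:(by rewrite sy).
      by rewrite E eqxx in uv.
    apply: eq_card => z; rewrite !inE /link /avoid eqxx (negbTE uv) orbF uQ /=.
    by rewrite andbC orbC.
  have [->|yv] := eqVneq y v.
    rewrite -(degL Q v u x') //; last 3 first.
    - by rewrite sy.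
    - by rewrite sy.
    - move=> q qQ vq; have [[_ E]|[]] // := out q v qQ vQ ltac:(by rewrite sy).
      by rewrite E eqxx in uv.
    apply: eq_card => z; rewrite !inE /link /avoid eqxx [v == u]eq_sym (negbTE uv) vQ /=.
    by rewrite andbC orbC.
  apply: eq_card => z; rewrite !inE /link /avoid (negbTE yu) (negbTE yv) yQ !orbF /=.
  case yz: (e y z) => //=; apply/negP => zQ.
  by have [[_ E]|[_ E]] := out z y zQ yQ ltac:(by rewrite sy);
    [rewrite E eqxx in yu|rewrite E eqxx in yv].
have uA := inA' xu; have vA := inA' x'v.
have grL : graph (A :\: Q) (link Q u v).
  split.
  - move=> a b; rewrite /link /avoid sy [(b \notin Q) && _]andbC.
    by rewrite [(a == u) && _]andbC [(a == v) && _]andbC [X in _ || X]orbC.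
  - move=> a; rewrite /link /avoid ir /=; apply/norP; split; apply/andP => -[/eqP-> /eqP E];
    by rewrite E eqxx in uv.
  - move=> a b /or3P[/and3P[/inA aA aQ _]|/andP[/eqP-> _]|/andP[/eqP-> _]];
    by rewrite inE ?aQ ?uQ ?vQ.
  - by move=> a aAQ; rewrite degE //; apply: degA; case/setDP: aAQ.
have QA' := card_setDA QA.
have Q1 : 0 < #|Q| by rewrite card_gt0; apply/set0Pn; exists x.
have [|f' [F' [/andP[/forall_inP FP tF] cF nF]] le] := IHA grL; first by lia.
(* A closed 5-set missing the new edge would be closed in the old graph; so it contains both ends,
   and there is at most one such set. *)
have hit S : S \in closed5 (A :\: Q) (link Q u v) -> u \in S /\ v \in S.
  rewrite inE => /and3P[/subsetP SA /eqP S5 /closed_setP cS].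
  have uvS : u \in S -> v \in S by move/cS; apply; rewrite /link !eqxx orbT.
  have vuS : v \in S -> u \in S by move/cS; apply; rewrite /link !eqxx !orbT.
  case: (boolP (u \in S)) => uS; first by split=> //; apply: uvS.
  case: (boolP (v \in S)) => vS; first by rewrite vuS in uS.
  exfalso; apply: (no5 _ S5); first by apply/subsetP => z /SA/setDP[].
  apply/closed_setP => a b aS ab; apply: (cS a) => //.
  have /setDP[_ aQ] := SA a aS; rewrite /link /avoid ab aQ /=.
  case: (boolP (b \in Q)) => //= bQ.
  by have [[_ E]|[_ E]] := out b a bQ aQ ltac:(by rewrite sy); rewrite E in aS;
    [rewrite aS in uS|rewrite aS in vS].
have K1 : #|closed5 (A :\: Q) (link Q u v)| <= 1.
  rewrite -(cards1 u); apply: (card_closed5 grL) => S /hit[uS _].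
  by exists u; rewrite ?inE.
have pA : packs e A (f' + 1).
  (* If all paths survive in the old graph, a path inside [Q] is added. Otherwise some [S0] uses the
     new edge, with third vertex [a]. *)
  case: (boolP [forall S in F', is_P3 e S]) => [/forall_inP eF|].
    rewrite -(setID A Q) (setIidPr QA) addnC; apply: packsU => //.
      by rewrite -setI_eq0 setIDA setDIl setDv set0I.
    by exists F'; split=> //; apply/andP; split=> //; apply/forall_inP.
  move=> /forall_inPn[S0 S0F nS0].
  have S0A y : y \in S0 -> y \in A /\ y \notin Q.
    by move=> yS; apply/setDP/(subsetP cF)/bigcupP; exists S0.
  have linkE y z : link Q u v y z -> ~~ e y z -> (y = u /\ z = v) \/ (y = v /\ z = u).
    by case/or3P=> [/and3P[->]|/andP[/eqP-> /eqP->]|/andP[/eqP-> /eqP->]] // _; [left|right].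
  have [a [aS uS vS S0E auv]] : exists a, [/\ a \in S0, u \in S0, v \in S0,
      S0 \subset [set a; u; v] & e a u \/ e a v].
    have /existsP[b1 /existsP[b2 /existsP[b3 /and5P[b12 b23 b13 l12 /andP[l23 /eqP E]]]]] :=
      FP _ S0F.
    have b1S : b1 \in S0 by rewrite E !inE eqxx.
    have b2S : b2 \in S0 by rewrite E !inE eqxx orbT.
    have b3S : b3 \in S0 by rewrite E !inE eqxx !orbT.
    case: (boolP (e b1 b2)) (boolP (e b2 b3)) => [e12|n12] [e23|n23].
    - case/negP: nS0; apply/existsP; exists b1; apply/existsP; exists b2.
      by apply/existsP; exists b3; rewrite b12 b23 b13 e12 e23 E eqxx.
    - exists b1; rewrite E; case: (linkE _ _ l23 n23) => -[E2 E3]; subst b2 b3;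
      (split; [by rewrite !inE eqxx | by rewrite !inE eqxx ?orbT
              | by rewrite !inE eqxx ?orbT | | by [left|right]]);
      apply/subsetP => y; rewrite !inE -!orbA; case/or3P=> ->; rewrite ?orbT //.
    - exists b3; rewrite E; case: (linkE _ _ l12 n12) => -[E1 E2]; subst b1 b2;
      (split; [by rewrite !inE eqxx ?orbT | by rewrite !inE eqxx ?orbT
              | by rewrite !inE eqxx ?orbT | | by [left; rewrite sy|right; rewrite sy]]);
      apply/subsetP => y; rewrite !inE -!orbA; case/or3P=> ->; rewrite ?orbT //.
    - case: (linkE _ _ l12 n12) (linkE _ _ l23 n23) => -[E1 E2] [] [E3 E4]; subst b1 b2 b3;
      by rewrite ?eqxx in b12 b23 b13.
  have [aA aQ] := S0A a aS.
  have p2 : packs e (Q :|: S0) (1 + 1).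
    (* [a y w] passes through the end [y] of the new edge into [Q]; the second path lies in the rest
       of [Q] with the other end [z]. *)
    have two y z w : w \in Q -> y \notin Q -> z \notin Q -> y \in S0 -> z \in S0 ->
        y != z -> ~~ e y z -> e a y -> e y w -> packs e (z |: Q :\ w) 1 ->
        packs e (Q :|: S0) (1 + 1).
      move=> wQ yQ zQ yS zS yz nyz ay yw pz.
      have az : a != z by apply: contraNneq nyz => <-; rewrite sy.
      have aw : a != w by apply: contraNneq aQ => ->.
      have wz : w != z by apply: contraNneq zQ => <-.
      apply: (@packs_subset _ e ([set a; y; w] :|: (z |: Q :\ w))).
        apply/subsetP => t; rewrite !inE -!orbA.
        case/or4P=> [/eqP->|/eqP->|/eqP->|/orP[/eqP->|/andP[_ ->]]] //;
        by rewrite ?aS ?yS ?zS ?wQ ?orbT.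
      apply: packsU => //.
        rewrite -setI_eq0; apply/eqP/setP => t; rewrite !inE.
        apply/andP => -[/orP[/orP[]|] /eqP->].
        - by rewrite (negbTE az) (negbTE aQ) andbF.
        - by rewrite (negbTE yz) (negbTE yQ) andbF.
        - by rewrite (negbTE wz) eqxx.
      apply: (@packs_P3 _ e _ a y w) => //; rewrite ?inE ?eqxx ?orbT //.
      by rewrite sy.
    case: auv => [au|av].
      by apply: (two u v x) => //; rewrite sy.
    by apply: (two v u x') => //; rewrite 1?eq_sym // sy.
  have pr : packs e (A :\: Q :\: S0) (f'.-1).
    exists (F' :\ S0); split; last 1 first.
    - have := cardsD1 S0 F'; rewrite S0F => c1; clear -nF c1; lia.
    - apply/andP; split; last by apply: trivIsetS tF; apply: subsetDl.
      apply/forall_inP => S /setD1P[SS0 SF].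
      (* The other paths avoid [u], which lies in [S0], and so cannot use the new edge. *)
      have uS' : u \notin S.
        apply/negP => uS'; have /trivIsetP/(_ _ _ SF S0F SS0)/pred0P/(_ u)/negP[] := tF.
        by apply/andP.
      have := FP _ SF.
      move=> /existsP[b1 /existsP[b2 /existsP[b3 /and5P[b12 b23 b13 l12 /andP[l23 /eqP E]]]]].
      apply/existsP; exists b1; apply/existsP; exists b2; apply/existsP; exists b3.
      rewrite b12 b23 b13 E eqxx; move: uS'; rewrite E !inE !negb_or -andbA => /and3P[u1 u2 u3].
      have le12 : e b1 b2.
        apply: contraT => /(linkE _ _ l12)[][Eu Ev]; by rewrite ?Eu ?Ev eqxx in u1 u2.
      rewrite le12 /= andbT.
      apply: contraT => /(linkE _ _ l23)[][Eu Ev]; by rewrite ?Eu ?Ev eqxx in u2 u3.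
  - apply/subsetP => y /bigcupP[S /setD1P[SS0 SF] yS]; rewrite inE (subsetP cF) ?andbT; last first.
      by apply/bigcupP; exists S.
    apply/negP => yS0; have /trivIsetP/(_ _ _ SF S0F SS0)/pred0P/(_ y)/negP[] := tF.
    by apply/andP.
  apply: (@packs_le _ _ _ (1 + 1 + f'.-1)); first by clear; lia.
  have := packsU _ p2 pr; rewrite setDDl.
  have -> : Q :|: S0 :|: A :\: (Q :|: S0) = A.
    apply/setP => y; rewrite !inE; case: (boolP (y \in Q)) => [/(subsetP QA)|_] //=.
    by case: (boolP (y \in S0)) => [/S0A[]|].
  by apply; rewrite -setI_eq0 setIDA setDIl setDv set0I.
(* With [k <= 1] closed 5-sets, [4 * (f' + 1) < #|A| <= #|Q| + 4 * f' + k] gives [4 < #|Q| + k],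
   which forces [k = 1] and [#|Q| = 4]. *)
have lt := bad pA.
case: (set_0Vmem (closed5 (A :\: Q) (link Q u v))) => [K0|[S SK]].
  by rewrite K0 cards0 in le; clear -le QA' lt Q4; lia.
split; [by clear -le QA' lt K1; lia| by []| by rewrite degE // inE uA uQ|].
by exists S; have [] := hit S SK.
Qed.

(** * Bridges and pendant sets *)

Definition pendant S t w :=
  [/\ S \subset A, #|S| = 5, t \in S, w \notin S & e t w /\ only_edge S t w].

(** Both ends keep degree 2 after the deletion, and packings of the smaller graph are packings of
    [e]. So minimality yields a closed 5-set of the smaller graph; it is not closed in [e] and
    contains exactly one end of the edge. *)
Lemma delete_edge v w : e v w -> deg e v = 3 -> deg e w = 3 ->
  exists S, pendant S v w \/ pendant S w v.
Proof.
move=> vw dv dw; set e' : rel T := fun x y =>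
  [&& e x y, ~~ ((x == v) && (y == w)) & ~~ ((x == w) && (y == v))].
have wv : e w v by rewrite sy.
have nvw := neq vw.
have dS x y : e x y -> #|nbrs e x :\ y| = (deg e x).-1.
  by move=> xy; rewrite /deg -/(nbrs e x) [in RHS](cardsD1 y) inE xy.
have degE x : x \in A -> 2 <= deg e' x <= 3.
  move=> xA; have [->|xv] := eqVneq x v.
    have -> : deg e' v = #|nbrs e v :\ w|.
      by apply: eq_card => y; rewrite !inE /e' eqxx (negbTE nvw) andbT andbC.
    by rewrite dS // dv.
  have [->|xw] := eqVneq x w.
    have -> : deg e' w = #|nbrs e w :\ v|.
      by apply: eq_card => y; rewrite !inE /e' eqxx [w == v]eq_sym (negbTE nvw) andbC.
    by rewrite dS // dw.
  have -> : deg e' x = deg e x.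
    by apply: eq_card => y; rewrite !inE /e' (negbTE xv) (negbTE xw) !andbT.
  exact: degA.
have gr' : graph A e'.
  split=> // [x y|x|x y /and3P[/inA]//]; last by rewrite /e' ir.
  by rewrite /e' sy [_ && (x == v)]andbC [_ && (x == w)]andbC [X in _ && X]andbC.
have sub x y : e' x y -> e x y by case/and3P.
have [|f pf le] := mc_fewer_edges mc gr'.
  apply: proper_card; apply/properP; split.
    by apply/subsetP => -[x y]; rewrite !inE; apply: sub.
  by exists (v, w); rewrite !inE //= /e' !eqxx andbF.
have lt : 4 * f < #|A| by apply: (mc_packs mc); apply: packs_subrel pf => x y _ _; apply: sub.
have /card_gt0P[S] : 0 < #|closed5 A e'| by clear -le lt; lia.
rewrite inE => /and3P[SA /eqP S5 /closed_setP cS]; exists S.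
have out x y : x \in S -> y \notin S -> e x y -> (x = v /\ y = w) \/ (x = w /\ y = v).
  move=> xS yS xy; case: (boolP (e' x y)) => [/(cS _ _ xS) yS'|]; first by rewrite yS' in yS.
  by rewrite /e' xy /= negb_and !negbK => /orP[]/andP[/eqP-> /eqP->]; [left|right].
case: (boolP (v \in S)) (boolP (w \in S)) => vS [] wS.
- exfalso; apply: (no5 SA S5); apply/closed_setP => x y xS xy; apply: contraT => yS.
  by have [[_ E]|[_ E]] := out x y xS yS xy; rewrite E ?vS ?wS in yS.
- left; split=> //; split=> // x y xS yS xy; have [//|[_ E]] := out x y xS yS xy.
  by rewrite E vS in yS.
- right; split=> //; split=> // x y xS yS xy; have [[_ E]|//] := out x y xS yS xy.
  by rewrite E wS in yS.
- exfalso; apply: (no5 SA S5); apply/closed_setP => x y xS xy; apply: contraT => yS.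
  by have [[E _]|[E _]] := out x y xS yS xy; rewrite E ?(negbTE vS) ?(negbTE wS) in xS.
Qed.

Section Pendant.
Variables (S : {set T}) (t w : T).
Hypothesis pS : pendant S t w.

Lemma pendant_inner x : x \in S -> x != t -> 2 <= #|nbrs e x :&: S|.
Proof.
case: pS => /subsetP SA _ tS wS [tw out] xS xt.
have -> : nbrs e x :&: S = nbrs e x.
  apply/setIidPl/subsetP => y; rewrite inE => xy; apply: contraNT xt => yS.
  by have [->] := out _ _ xS yS xy.
by have /andP[] := degA (SA x xS).
Qed.

Lemma pendant_nbr : exists2 t', t' \in S & e t t'.
Proof.
case: pS => SA _ tS wS [tw out]; have [a [b [ab ta tb]]] := graph_nbr2 gr (inA tw).
case: (boolP (a \in S)) => aS; first by exists a.
case: (boolP (b \in S)) => bS; first by exists b.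
have [_ E] := out _ _ tS aS ta; have [_ E'] := out _ _ tS bS tb.
by rewrite E E' eqxx in ab.
Qed.

(** [t] spends one of its at most three edges on [w], which leaves at most two inside [S]. *)
Lemma pendant_core t' : t' \in S -> e t t' -> packs e (S :\ t :\ t') 1.
Proof.
move=> t'S tt'; case: pS => /subsetP SA S5 tS wS [tw out].
apply: packs_core => //; first exact: pendant_inner.
  have : #|nbrs e t :&: S| < #|nbrs e t|.
    apply: proper_card; apply/properP; split; first exact: subsetIl.
    by exists w; rewrite !inE // (negbTE wS) andbF.
  by have /andP[_] := degA (SA _ tS); rewrite -[#|nbrs e t|]/(deg e t); clear; lia.
have /andP[_ d3] := degA (SA _ t'S).
by apply: leq_trans d3; apply/subset_leq_card/subsetIl.
Qed.

Lemma pendant_packs : packs e (S :\ t) 1.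
Proof.
have [t' t'S tt'] := pendant_nbr.
by apply: packs_subset (pendant_core t'S tt'); apply: subsetDl.
Qed.

End Pendant.

Lemma seq_subA (s : seq T) : all (mem A) s -> [set:: s] \subset A.
Proof. by move=> /allP sA; apply/subsetP => x; rewrite inE => /sA. Qed.

(** Otherwise [min_link] replaces the three vertices of degree 2 by an edge [u v], but it would
    require a set of at least four vertices. *)
Lemma path3_contract p q r u v :
  (forall y, e p y = (y == q) || (y == u)) -> (forall y, e q y = (y == p) || (y == r)) ->
  (forall y, e r y = (y == q) || (y == v)) ->
  u != q -> v != q -> p != r -> u != r -> (u == v) || e u v.
Proof.
move=> Np Nq Nr uq vq pr ur; apply: contraT; rewrite negb_or => /andP[uv nuv].
have pq : e p q by rewrite Np eqxx.
have qr : e q r by rewrite Nq eqxx orbT.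
have pu : e p u by rewrite Np eqxx orbT.
have rv : e r v by rewrite Nr eqxx orbT.
have rq : e r q by rewrite sy.
have vp : v != p.
  apply: contraNneq ur => E; move: rv; rewrite E sy Np eq_sym => /orP[/eqP E'|/eqP->//].
  by rewrite E' ir in qr.
have pQ : p \in [set:: [:: p; q; r]] by rewrite !inE eqxx.
have rQ : r \in [set:: [:: p; q; r]] by rewrite !inE eqxx !orbT.
have qp : q != p by rewrite eq_sym neq.
have rp : r != p by rewrite eq_sym.
have Q3 := cards_seq_le [:: p; q; r].
have [] := @min_link [set:: [:: p; q; r]] p r u v (leqW Q3) _ pQ rQ _ _ uv nuv pu rv.
- by apply: seq_subA; rewrite /= (inA pu) (inA qr) (inA rv).
- by rewrite !inE !negb_or [u == p]eq_sym (neq pu) uq ur.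
- by rewrite !inE !negb_or [v == r]eq_sym (neq rv) vq vp.
- move=> a b; rewrite !inE => /or3P[]/eqP->; rewrite ?Np ?Nq ?Nr => /norP[bp /norP[bq br]].
  + by rewrite (negbTE bq) => /eqP->; left.
  + by rewrite (negbTE bp) (negbTE br).
  + by rewrite (negbTE bq) => /eqP->; right.
- by apply: (@packs_P3 _ _ _ p q r); rewrite ?inE ?eqxx ?orbT // sy.
- by apply: (@packs_P3 _ _ _ q r v); rewrite ?inE ?qp ?rp ?eqxx ?orbT // eq_sym.
- by apply: (@packs_P3 _ _ _ u p q); rewrite ?inE ?pr ?(neq qr) ?eqxx ?orbT.
- by move=> /leq_trans/(_ Q3).
Qed.

(** The path [w t t'] takes in the outer vertex, and the other three vertices of [S] form a second
    path. *)
Lemma pendant_packs_out S t w : pendant S t w -> packs e (w |: S) 2.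
Proof.
move=> pS; have [t' t'S tt'] := pendant_nbr pS; have cr := pendant_core pS t'S tt'.
case: pS => SA S5 tS wS [tw out].
apply: (@packs_subset _ e ([set:: [:: w; t; t']] :|: (S :\ t :\ t'))).
  apply/subsetP => x; rewrite !inE => /orP[/or3P[]/eqP->|/and3P[_ _ ->]];
  by rewrite ?eqxx ?tS ?t'S ?orbT.
apply: (@packsU _ _ _ _ 1 1) => //.
  rewrite -setI_eq0; apply/eqP/setP => x; rewrite !inE; apply/andP => -[/or3P[]/eqP->];
  by rewrite ?eqxx ?(negbTE wS) ?andbF.
apply: (@packs_P3 _ _ _ w t t') => //; rewrite ?inE ?eqxx ?orbT //.
by apply: contraNneq wS => ->.
Qed.

(** Meant for the differences of two overlapping pendant sets. Vertices other than [x0] have all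
    neighbours in [X]. If there are three of them, their degrees sum to at least six and at most
    three edges go to [x0], so they span two edges. *)
Lemma small_only_edge X x0 y0 : X \subset A -> x0 \in X -> only_edge X x0 y0 -> #|X| <= 4 ->
  [/\ 3 <= #|X|, packs e X 1 & #|X| = 4 -> packs e (X :\ x0) 1].
Proof.
move=> /subsetP XA x0X out X4.
have inn x y : x \in X -> x != x0 -> e x y -> y \in X.
  move=> xX xn xy; apply: contraNT xn => yX; by have [->] := out _ _ xX yX xy.
have [a aX a0] : exists2 a, a \in X & a != x0.
  have [a [b [ab xa xb]]] := graph_nbr2 gr (XA _ x0X).
  case: (boolP (a \in X)) => aX; first by exists a => //; rewrite eq_sym neq.
  case: (boolP (b \in X)) => bX; first by exists b => //; rewrite eq_sym neq.
  have [_ E] := out _ _ x0X aX xa; have [_ E'] := out _ _ x0X bX xb.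
  by rewrite E E' eqxx in ab.
have [b [c [bc ab ac]]] := graph_nbr2 gr (XA _ aX).
have bX := inn _ _ aX a0 ab; have cX := inn _ _ aX a0 ac.
split.
- have abc : uniq [:: a; b; c] by rewrite /= !inE negb_or (neq ab) (neq ac) bc.
  rewrite -[3]/(size [:: a; b; c]) -(cards_seq_uniq abc).
  by apply/subset_leq_card/subsetP => x; rewrite !inE => /or3P[]/eqP->.
- exact: (@packs_P3 _ _ _ b a c).
- move=> E4; have : #|X :\ x0| = 3 by have := cardsD1 x0 X; rewrite x0X E4; clear; lia.
  move=> /card3P[x [y [z [xy yz xz E]]]].
  have inS v : v \in [set x; y; z] -> 2 <= e v x0 + (e v x + (e v y + e v z)).
    rewrite -E !inE => /andP[v0 vX].
    have /andP[d2 _] := degA (XA _ vX); apply: leq_trans d2 _.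
    have -> : deg e v = #|nbrs e v :&: X|.
      congr #|pred_of_set _|; apply/esym/setIidPl/subsetP => w; rewrite inE; exact: inn.
    rewrite card_nbrsI (big_setD1 x0) //= E.
    by rewrite -setUA big_setU1 ?big_setU1 ?big_set1 //= !inE ?negb_or ?xy ?xz ?yz.
  have dx := inS x ltac:(by rewrite !inE eqxx).
  have dy := inS y ltac:(by rewrite !inE eqxx orbT).
  have dz := inS z ltac:(by rewrite !inE eqxx !orbT).
  apply: (@P3_of_edges _ e _ x y z) => //; rewrite ?E ?inE ?eqxx ?orbT //.
  move: dx dy dz; rewrite !ir (sy y x) (sy z x) (sy z y); clear.
  have := leq_b1 (e x x0); have := leq_b1 (e y x0); have := leq_b1 (e z x0).
  move: (nat_of_bool (e x y)) (nat_of_bool (e y z)) (nat_of_bool (e x z)) => i j k.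
  move: (nat_of_bool (e x x0)) (nat_of_bool (e y x0)) (nat_of_bool (e z x0)) => i' j' k'.
  rewrite /=; lia.
Qed.

(** If [w] had degree 2, follow [t w y z]. For [y] of degree 3, removing [w |: S] would give
    [8 < 6 + 1]; for [z] of degree 3, removing [y] as well would give [8 < 7 + 1]. Otherwise
    [path3_contract] makes [t] and the vertex [z2] after [z] equal or adjacent, against the single
    edge leaving [S]. *)
Lemma pendant_deg3 S t w : pendant S t w -> deg e w = 3.
Proof.
move=> pS; have p2 := pendant_packs_out pS.
case: (pS) => SA S5 tS wS [tw out].
have wt : e w t by rewrite sy.
have [d2|//] := min_deg23 wt; exfalso.
have [y yt Nw] := deg2P d2 wt.
have wy : e w y by rewrite Nw eqxx orbT.
have yw : e y w by rewrite sy.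
have inS x z : x \in S -> e x z -> z != w -> z \in S.
  by move=> xS xz; apply: contraNT => zS; have [_ ->] := out _ _ xS zS xz.
have yS : y \notin S.
  by apply: contraNN yt => yS; have [->] := out _ _ yS wS yw.
have QA : w |: S \subset A by rewrite subUset sub1set (inA wt).
have Q0 : w |: S != set0 by apply/set0Pn; exists w; rewrite !inE eqxx.
have Q6 : #|w |: S| = 6 by rewrite cardsU1 wS S5.
have [dy|dy] := min_deg23 yw; last first.
  suff : 4 * 2 < #|w |: S| + #|[set y]| by rewrite Q6 cards1.
  apply: (min_remove) => // q x; rewrite !inE => /orP[/eqP->|qS] /norP[xw xS] qx.
    move: qx; rewrite Nw => /orP[] /eqP E; subst x; first by rewrite tS in xS.
    split=> // q'; rewrite !inE => /orP[/eqP//|q'S] q'y.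
    by rewrite (inS _ _ q'S q'y xw) in yS.
  by rewrite (inS _ _ qS qx xw) in xS.
have [z zw Ny] := deg2P dy yw.
have yz : e y z by rewrite Ny eqxx orbT.
have zy : e z y by rewrite sy.
have yw' : y != w := neq yw.
have zt : z != t.
  by apply: contraNneq yS => E; apply: (inS t) => //; rewrite -E.
have zS : z \notin S.
  by apply: contraNN yS => zS; apply: (inS z).
have yQ : y \notin w |: S by rewrite !inE negb_or yw'.
have [dz|dz] := min_deg23 zy; last first.
  suff : 4 * 2 < #|y |: (w |: S)| + #|[set z]| by rewrite cardsU1 yQ Q6 cards1.
  apply: (min_remove); last first.
  - have uni q : q \in y |: (w |: S) -> e q z -> q = y.
      rewrite !inE => /or3P[/eqP//|/eqP->|qS] qz.
        by move: qz; rewrite Nw (negbTE zt) /= => /eqP E; rewrite E ir in yz.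
      by rewrite (inS _ _ qS qz zw) in zS.
    move=> q x; rewrite !inE => /or3P[/eqP->|/eqP->|qS] /norP[xy /norP[xw xS]] qx.
    + move: (qx); rewrite Ny (negbTE xw) /= => /eqP E; subst x.
      by split=> // q' q'Q q'z; rewrite (uni q').
    + move: qx; rewrite Nw (negbTE xy) orbF => /eqP E; by rewrite E tS in xS.
    + by rewrite (inS _ _ qS qx xw) in xS.
  - exact: packs_subset (subsetUr _ _) p2.
  - by apply/set0Pn; exists y; rewrite !inE eqxx.
  - by rewrite subUset sub1set (inA yw).
have [z2 z2y Nz] := deg2P dz zy.
have zz2 : e z z2 by rewrite Nz eqxx orbT.
have : (t == z2) || e t z2.
  apply: (@path3_contract w y z) => //.
  - by move=> x; rewrite Nw orbC.
  - by rewrite eq_sym.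
  - by rewrite eq_sym.
  - by rewrite eq_sym.
case/orP=> [/eqP E|tz2].
  by case/negP: zS; apply: (inS t) => //; rewrite E sy.
have [E|z2w] := eqVneq z2 w.
  move: zz2; rewrite E sy Nw (negbTE zt) /= => /eqP E'; by rewrite E' ir in yz.
have z2S := inS _ _ tS tz2 z2w.
by case/negP: zS; apply: (inS z2) => //; rewrite sy.
Qed.

(** * Disjointness of pendant sets *)

Lemma closed_le5 Q : Q \subset A -> Q != set0 -> closed_set e Q -> #|Q| <= 5 -> False.
Proof. by move=> QA Q0 cl; rewrite leqNgt (min_closed_gt4 QA Q0 cl). Qed.

Lemma pendant_diff0 S t w S' t' w' : pendant S t w -> pendant S' t' w' ->
  S != S' -> S :\: S' != set0.
Proof.
case=> _ c1 _ _ _ [_ c2 _ _ _]; apply: contraNneq => E.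
by rewrite eqEcard c1 c2 leqnn andbT -setD_eq0 E.
Qed.

(* If the far end of the edge leaving [S'] is outside [S], the difference or the
   intersection of the two sets has no outgoing edge. *)
Lemma pendant_disjoint_aux S t w S' t' w' : pendant S t w -> pendant S' t' w' ->
  S != S' -> w' \notin S -> S :&: S' == set0.
Proof.
move=> p1 p2 ne w'S; have D0 := pendant_diff0 p1 p2 ne; case: p1 => SA S5 tS wS [tw out].
case: p2 => SA' S5' tS' wS' [tw' out'].
have eI x y : x \in S' -> x \in S -> y \in S -> e x y -> y \in S'.
  by move=> xS' xS yS xy; apply: contraNT w'S => yS'; have [_ <-] := out' _ _ xS' yS' xy.
have D5 : #|S :\: S'| <= 5 by rewrite -S5; apply/subset_leq_card/subsetDl.
have I5 : #|S :&: S'| <= 5 by rewrite -S5; apply/subset_leq_card/subsetIl.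
have [tS1|tS1] := boolP (t \in S').
  case: (closed_le5 (subset_trans (subsetDl _ _) SA) D0 _ D5); apply/closed_setP => x y.
  move=> /setDP[xS xS'] xy.
  have yS : y \in S by apply: contraNT xS' => yS; have [->] := out _ _ xS yS xy.
  by rewrite inE yS andbT; apply: contra xS' => yS'; apply: (eI y) => //; rewrite sy.
apply: contraT => I0.
case: (closed_le5 (subset_trans (subsetIl _ _) SA) I0 _ I5); apply/closed_setP => x y.
move=> /setIP[xS xS'] xy.
have yS : y \in S by apply: contraNT tS1 => yS; have [<-] := out _ _ xS yS xy.
by rewrite inE yS; apply: (eI x).
Qed.
Lemma pendant_disjoint S t w S' t' w' : pendant S t w -> pendant S' t' w' ->
  S != S' -> [disjoint S & S'].
Proof.
move=> p1 p2 ne; rewrite -setI_eq0.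
have [w'S|] := boolP (w' \in S); last exact: pendant_disjoint_aux p1 p2 ne.
have [wSS|wSS] := boolP (w \in S'); last first.
  by rewrite setIC; apply: pendant_disjoint_aux p2 p1 _ wSS; rewrite eq_sym.
apply: contraT => I0.
have D0 := pendant_diff0 p1 p2 ne.
have D0' : S' :\: S != set0 by apply: pendant_diff0 p2 p1 _; rewrite eq_sym.
case: p1 p2 => SA S5 tS wS [tw out] [SA' S5' tS' wS' [tw' out']].
have I5 : #|S :&: S'| <= 5 by rewrite -S5; apply/subset_leq_card/subsetIl.
(* If [t] is outside [S'], the edge from [w] to [t] leaves [S'], so it is the outgoing edge of both
   sets and the intersection is closed. *)
have [tI|tI] := boolP (t \in S'); last first.
  have [E E'] : w = t' /\ t = w' by apply: out' => //; rewrite sy.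
  exfalso; apply: (closed_le5 (subset_trans (subsetIl _ _) SA) I0 _ I5).
  apply/closed_setP => x y /setIP[xS xS'] xy.
  have yS : y \in S by apply: contraNT tI => yS; have [<-] := out _ _ xS yS xy.
  rewrite inE yS; apply: contraNT wS => yS'; have [E1 _] := out' _ _ xS' yS' xy.
  by rewrite E -E1.
have [t'I|t'I] := boolP (t' \in S); last first.
  have [E E'] : w' = t /\ t' = w by apply: out => //; rewrite sy.
  exfalso; apply: (closed_le5 (subset_trans (subsetIl _ _) SA) I0 _ I5).
  apply/closed_setP => x y /setIP[xS xS'] xy.
  have yS : y \in S' by apply: contraNT t'I => yS; have [<-] := out' _ _ xS' yS xy.
  rewrite inE yS andbT; apply: contraNT wS' => yS'; have [E1 _] := out _ _ xS yS' xy.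
  by rewrite E -E1.
(* With [t] and [t'] in both sets, each difference has only one edge leaving it, which ends in the
   intersection. *)
have oX : only_edge (S :\: S') w' t'.
  move=> x y /setDP[xS xS']; rewrite inE negb_and negbK => yX xy.
  have yS : y \in S by apply: contraNT xS' => yS; have [->] := out _ _ xS yS xy.
  move: yX; rewrite yS orbF => yS'.
  by have [] := out' _ _ yS' xS' (etrans (sy _ _) xy).
have oY : only_edge (S' :\: S) w t.
  move=> x y /setDP[xS xS']; rewrite inE negb_and negbK => yX xy.
  have yS : y \in S' by apply: contraNT xS' => yS; have [->] := out' _ _ xS yS xy.
  move: yX; rewrite yS orbF => yS'.
  by have [] := out _ _ yS' xS' (etrans (sy _ _) xy).
have cX := cardsID S' S; have cY := cardsID S S'; rewrite (setIC S' S) in cY.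
have cI : 0 < #|S :&: S'| by rewrite card_gt0.
have XA := subset_trans (subsetDl S S') SA; have YA := subset_trans (subsetDl S' S) SA'.
have w'X : w' \in S :\: S' by rewrite inE w'S wS'.
have wY : w \in S' :\: S by rewrite inE wS wSS.
have X4 : #|S :\: S'| <= 4 by clear -cX cI S5; lia.
have Y4 : #|S' :\: S| <= 4 by clear -cY cI S5'; lia.
have [X3 pX pX'] := small_only_edge XA w'X oX X4.
have [Y3 pY pY'] := small_only_edge YA wY oY Y4.
have cU : #|S :|: S'| = #|S| + #|S' :\: S|.
  by rewrite cardsU [S :&: S']setIC; have := cardsID S S'; clear; lia.
have clU : closed_set e (S :|: S').
  apply/closed_setP => x y /setUP[] xS xy; rewrite inE; apply: contraT;
    rewrite negb_or => /andP[yS yS'].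
    by have [_ E] := out _ _ xS yS xy; rewrite E wSS in yS'.
  by have [_ E] := out' _ _ xS yS' xy; rewrite E w'S in yS.
have UA : S :|: S' \subset A by rewrite subUset SA.
have U0 : S :|: S' != set0 by apply/set0Pn; exists t; rewrite inE tS.
have dXY : [disjoint S :\: S' & S' :\: S].
  by rewrite -setI_eq0; apply/eqP/setP => x; rewrite !inE; do 2!case: (x \in _).
(* Differences of three vertices: the closed union has eight vertices and holds two paths, which is
   excluded. *)
have [E3|n3] := eqVneq #|S' :\: S| 3.
  have := min_closed_packs UA U0 clU (f := 2); rewrite cU S5 E3 => /(_ _)/negP; case=> //.
  apply: packs_subset (packsU dXY pX pY).
  by apply/subsetP => x; rewrite !inE; do 2!case: (x \in _).
(* Differences of four vertices: [t = t'] is the only common vertex, and [w t w'] is a third path in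
   a closed union of nine vertices. *)
have E4 : #|S' :\: S| = 4 by clear -Y4 Y3 n3; lia.
have E4' : #|S :\: S'| = 4 by clear -cX cY S5 S5' E4; lia.
have tt' : t' = t.
  have /eqP/cards1P[z Ez] : #|S :&: S'| = 1 by clear -cX S5 E4'; lia.
  have : t \in [set z] /\ t' \in [set z] by rewrite -Ez !inE tS tI t'I tS'.
  by rewrite !inE => -[/eqP-> /eqP->].
have := min_closed_packs UA U0 clU (f := 1 + 1 + 1); rewrite cU S5 E4 => /(_ _)/negP; case=> //.
apply: (@packs_subset _ _ ([set:: [:: w; t; w']] :|: (S :\: S' :\ w' :|: (S' :\: S :\ w)))).
  apply/subsetP => x; rewrite !inE => /orP[/or3P[]/eqP->|/orP[/and3P[_ _ ->]|/and3P[_ _ ->]]];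
  by rewrite ?wSS ?tS ?w'S ?orbT.
apply: (@packsU _ _ _ _ 1 2) => //.
- rewrite -setI_eq0; apply/eqP/setP => x; rewrite !inE; apply/andP => -[/or3P[]/eqP->];
  by rewrite ?eqxx ?(negbTE wS) ?(negbTE wS') ?tS ?tI ?andbF.
- apply: (@packs_P3 _ _ _ w t w') => //; rewrite ?inE ?eqxx ?orbT //.
    by apply: contraNneq wS => ->.
  by rewrite -tt'.
- apply: (@packsU _ _ _ _ 1 1); [|exact: pX'|exact: pY'].
  by apply: disjointWl (disjointWr _ dXY); apply: subsetDl.
Qed.

(** If [w] were in another pendant set, the edge [t w] would be the outgoing edge of both, and their
    union would be closed with ten vertices and three paths. *)
Lemma pendant_far_end S t w S' t' w' : pendant S t w -> pendant S' t' w' -> w \notin S'.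
Proof.
move=> p1 p2; have [<-|ne] := eqVneq S S'; first by case: p1.
have := pendant_disjoint p1 p2 ne; rewrite -setI_eq0 => /eqP/setP dS.
have p22 := pendant_packs_out p1.
case: (p1) (p2) => SA S5 tS wS [tw out] [SA' S5' tS' wS' [tw' out']].
apply/negP => wS1; have tS1 : t \notin S' by move: (dS t); rewrite !inE tS /= => ->.
have wt : e w t by rewrite sy.
have [E E'] := out' _ _ wS1 tS1 wt; subst t' w'.
have UA : S :|: S' \subset A by rewrite subUset SA.
have U0 : S :|: S' != set0 by apply/set0Pn; exists t; rewrite inE tS.
have clU : closed_set e (S :|: S').
  apply/closed_setP => x y /setUP[] xS xy; rewrite inE; apply: contraT;
    rewrite negb_or => /andP[yS yS'].
    by have [_ Ey] := out _ _ xS yS xy; rewrite Ey wS1 in yS'.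
  by have [_ Ey] := out' _ _ xS yS' xy; rewrite Ey tS in yS.
have : 4 * (2 + 1) < #|S :|: S'|.
  apply: (min_closed_packs) => //.
  apply: (@packs_subset _ _ ((w |: S) :|: (S' :\ w))).
    by apply/subsetP => x; rewrite !inE => /orP[/orP[/eqP->|->]|/andP[_ ->]]; rewrite ?wS1 ?orbT.
  apply: packsU => //; last exact: (pendant_packs p2).
  rewrite -setI_eq0; apply/eqP/setP => x; rewrite !inE; have := dS x; rewrite !inE.
  by case: (x == w) => //=.
by rewrite cardsU S5 S5'; clear; lia.
Qed.

(** * Three consecutive vertices of degree 2: pendant cycles *)

Lemma pendant_C4 p q r u y z :
  (forall x, e p x = (x == q) || (x == u)) -> (forall x, e q x = (x == p) || (x == r)) ->
  (forall x, e r x = (x == q) || (x == u)) ->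
  (forall x, e u x = [|| x == p, x == r | x == y]) -> (forall x, e y x = (x == u) || (x == z)) ->
  u != q -> p != r -> y != p -> y != r -> z != u ->
  pendant [set:: [:: p; q; r; u; y]] y z.
Proof.
move=> Np Nq Nr Nu Ny uq pr yp yr zu.
have pq : e p q by rewrite Np eqxx.
have pu : e p u by rewrite Np eqxx orbT.
have qr : e q r by rewrite Nq eqxx orbT.
have ru : e r u by rewrite Nr eqxx orbT.
have uy : e u y by rewrite Nu eqxx !orbT.
have yz : e y z by rewrite Ny eqxx orbT.
have zy : e z y by rewrite sy.
have qu : ~~ e q u by rewrite Nq negb_or !(eq_sym u) (neq pu) (neq ru).
have yq : y != q by apply: contraNneq qu => <-; rewrite sy.
have un : uniq [:: p; q; r; u; y].
  rewrite /= !inE !negb_or (neq pq) pr (neq pu) (neq qr) (neq ru) (neq uy).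
  by rewrite ![_ == y]eq_sym yp yq yr eq_sym uq.
have zS : z \notin [set:: [:: p; q; r; u; y]].
  rewrite !inE !negb_or zu ![z == y]eq_sym (neq yz) andbT /=.
  have zn x : ~~ e x y -> z != x by move=> h; apply: contraNneq h => <-.
  by rewrite !zn // ?Np ?Nq ?Nr negb_or ?yq ?yp ?yr //= eq_sym neq.
split=> //.
- by apply: seq_subA; rewrite /= (inA pq) (inA qr) (inA ru) (inA uy) (inA yz).
- exact: cards_seq_uniq un.
- by rewrite !inE eqxx !orbT.
split=> // a b; rewrite !inE => aS bS; move: bS; rewrite !negb_or => /and5P[bp bq br bu b_y].
by case/or4P: aS => [/eqP->|/eqP->|/eqP->|/orP[]/eqP->]; rewrite ?Np ?Nq ?Nr ?Nu ?Ny
  ?(negbTE bp) ?(negbTE bq) ?(negbTE br) ?(negbTE bu) ?(negbTE b_y) //= => /eqP->.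
Qed.

(** The hypotheses describe the 5-cycle [p q r v u]; the third edge at [v] is the one that
    leaves. *)
Lemma pendant_C5 p q r u v :
  (forall x, e p x = (x == q) || (x == u)) -> (forall x, e q x = (x == p) || (x == r)) ->
  (forall x, e r x = (x == q) || (x == v)) -> (forall x, e u x = (x == p) || (x == v)) ->
  deg e v = 3 -> u != q -> v != q -> p != r -> u != r -> 
  exists y, pendant [set:: [:: p; q; r; u; v]] v y.
Proof.
move=> Np Nq Nr Nu dv uq vq pr ur.
have pq : e p q by rewrite Np eqxx.
have pu : e p u by rewrite Np eqxx orbT.
have qr : e q r by rewrite Nq eqxx orbT.
have rv : e r v by rewrite Nr eqxx orbT.
have uv : e u v by rewrite Nu eqxx orbT.
have vr : e v r by rewrite sy.
have vu : e v u by rewrite sy.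
have vp : v != p.
  apply: contraNneq pr => E; move: rv; rewrite E sy Np => /orP[]/eqP E'; subst r.
    by rewrite ir in qr.
  by rewrite eqxx in ur.
have ru : r != u by rewrite eq_sym.
have [y [yr yu Nv]] := deg3P2 dv vr vu ru.
have vy : e v y by rewrite Nv eqxx !orbT.
have un : uniq [:: p; q; r; u; v].
  rewrite /= !inE !negb_or (neq pq) pr (neq pu) (neq qr) (neq rv) (neq uv) ru.
  by rewrite ![_ == v]eq_sym vp vq eq_sym uq.
exists y; split=> //.
- by apply: seq_subA; rewrite /= (inA pq) (inA qr) (inA rv) (inA uv) (inA vy).
- exact: cards_seq_uniq un.
- by rewrite !inE eqxx !orbT.
- rewrite !inE !negb_or yr yu eq_sym [y == v]eq_sym (neq vy) /= andbT.
  have yn x : ~~ e x v -> x != y by move=> h; apply: contraNneq h => ->; rewrite sy.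
  rewrite yn /=; last by rewrite Np negb_or vq eq_sym neq.
  by rewrite eq_sym yn // Nq negb_or vp eq_sym neq.
split=> // a b; rewrite !inE => aS bS; move: bS; rewrite !negb_or => /and5P[bp bq br bu b_y].
by case/or4P: aS => [/eqP->|/eqP->|/eqP->|/orP[]/eqP->]; rewrite ?Np ?Nq ?Nr ?Nu ?Nv
  ?(negbTE bp) ?(negbTE bq) ?(negbTE br) ?(negbTE bu) ?(negbTE b_y) //= => /eqP->.
Qed.

(** The outer neighbours [u] and [v] of the path are equal or adjacent by [path3_contract], which
    closes a 4-cycle or a 5-cycle, unless [p q r] is a triangle. A cycle without exit is a closed
    set that is too small; those with an exit are pendant or contradict [delete_edge]. *)
Lemma deg2_middle_pendant p q r : deg e p = 2 -> deg e q = 2 -> deg e r = 2 ->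
  e q p -> e q r -> p != r -> exists S t w, pendant S t w /\ q \in S.
Proof.
move=> dp dq dr qp qr pr.
have pq : e p q by rewrite sy.
have rq : e r q by rewrite sy.
have [r' r'p Nq] := deg2P dq qp.
have Er : r' = r by move: qr; rewrite Nq eq_sym (negbTE pr) => /eqP->.
subst r'.
have [u uq Np] := deg2P dp pq; have [v vq Nr] := deg2P dr rq.
have pu : e p u by rewrite Np eqxx orbT.
have rv : e r v by rewrite Nr eqxx orbT.
have up : e u p by rewrite sy.
have vr : e v r by rewrite sy.
have [Eu|ur] := eqVneq u r.
  subst u; have Ev : v = p.
    by move: pu; rewrite sy Nr (negbTE (neq pq)) => /eqP->.
  subst v; exfalso; apply: (closed_le5 (Q := [set:: [:: p; q; r]])).
  - by apply: seq_subA; rewrite /= (inA pq) (inA qr) (inA rv).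
  - by apply/set0Pn; exists p; rewrite !inE eqxx.
  - by apply/closed_setP => x y; rewrite !inE => /or3P[]/eqP->; rewrite ?Np ?Nq ?Nr => /orP[]/eqP->;
    rewrite eqxx ?orbT.
  - exact: leq_trans (cards_seq_le _) _.
have vp : v != p.
  apply: contraNneq ur => E; move: rv; rewrite E sy Np [r == u]eq_sym => /orP[/eqP E'|//].
  by rewrite E' ir in qr.
have := path3_contract Np Nq Nr uq vq pr ur => /orP[/eqP E|uv].
  subst v; have ru : e r u by [].
  have ru' : e u r by [].
  have [du|du] := min_deg23 up.
    have [b bp Nu] := deg2P du up.
    have Eb : b = r by move: vr; rewrite Nu eq_sym (negbTE pr) => /eqP->.
    subst b; exfalso; apply: (closed_le5 (Q := [set:: [:: p; q; r; u]])).
    - by apply: seq_subA; rewrite /= (inA pq) (inA qr) (inA rv) (inA up).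
    - by apply/set0Pn; exists p; rewrite !inE eqxx.
    - apply/closed_setP => x y; rewrite !inE => /or4P[]/eqP->;
      rewrite ?Np ?Nq ?Nr ?Nu => /orP[]/eqP->;
      by rewrite eqxx ?orbT.
    - exact: leq_trans (cards_seq_le _) _.
  have [y [yp yr Nu]] := deg3P2 du up ru' pr.
  have uy : e u y by rewrite Nu eqxx !orbT.
  have yu : e y u by rewrite sy.
  have qu : ~~ e q u by rewrite Nq negb_or !(eq_sym u) (neq pu) (neq ru).
  have yq : y != q by apply: contraNneq qu => <-.
  have [dy|dy] := min_deg23 yu.
    have [z zu Ny] := deg2P dy yu.
    exists [set:: [:: p; q; r; u; y]], y, z; split; last by rewrite !inE eqxx orbT.
    exact: pendant_C4.
  (* A pendant set at [u] contains the whole 4-cycle, and the rest of it would be closed. *)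
  exfalso; have [S [pS|pS]] := delete_edge uy du dy; case: (pS) => SA S5 uS yS [_ out].
    have inS a b : a \in S -> e a b -> b != y -> b \in S.
      by move=> aS ab; apply: contraNT => bS; have [_ ->] := out _ _ aS bS ab.
    have pS' : p \in S by apply: (inS u); rewrite // eq_sym.
    have rS' : r \in S by apply: (inS u); rewrite // eq_sym.
    have qS' : q \in S by apply: (inS p); rewrite // eq_sym.
    have sub4 := cards_seq_le [:: p; q; r; u].
    have D := cardsID [set:: [:: p; q; r; u]] S.
    have I4 : #|S :&: [set:: [:: p; q; r; u]]| <= 4.
      by apply: leq_trans sub4; apply/subset_leq_card/subsetIr.
    apply: (closed_le5 (Q := S :\: [set:: [:: p; q; r; u]])).
    - exact: subset_trans (subsetDl _ _) SA.
    - by rewrite -card_gt0; clear -D I4 S5; lia.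
    - apply/closed_setP => a b; rewrite !inE !negb_or => /andP[/and4P[ap aq ar au] aS] ab.
      have bS : b \in S by apply: contraNT au => bS; have [->] := out _ _ aS bS ab.
      rewrite bS andbT; apply/and4P; split; apply: contraTneq ab => ->; rewrite sy ?Np ?Nq ?Nr ?Nu.
      + by rewrite (negbTE aq) (negbTE au).
      + by rewrite (negbTE ap) (negbTE ar).
      + by rewrite (negbTE aq) (negbTE au).
      + by rewrite (negbTE ap) (negbTE ar) /=; apply: contraNneq yS => <-.
    - by rewrite -S5; apply/subset_leq_card/subsetDl.
  (* A pendant set at [y] misses the 4-cycle; their union is closed, has at most nine vertices and
     holds three paths. *)
  have inS a : a \in S -> e a u -> a = y by move=> aS au; have [] := out _ _ aS yS au.
  have outS a : a \in S -> a != y -> forall b, e a b -> b \in S.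
    by move=> aS ay b ab; apply: contraNT ay => bS; have [->] := out _ _ aS bS ab.
  have pS' : p \notin S by apply: contraNN yp => pS'; rewrite (inS p).
  have rS' : r \notin S by apply: contraNN yr => rS'; rewrite (inS r).
  have qS' : q \notin S.
    by apply: contraNN pS' => qS'; apply: (outS q); rewrite // eq_sym.
  have p2 := pendant_packs_out pS.
  have d3 : [disjoint [set:: [:: p; q; r]] & u |: S].
    rewrite -setI_eq0; apply/eqP/setP => x; rewrite !inE; apply/andP => -[/or3P[]/eqP->];
    rewrite ?(negbTE pS') ?(negbTE qS') ?(negbTE rS') orbF.
    - by rewrite (negbTE (neq pu)).
    - by rewrite eq_sym (negbTE uq).
    - by rewrite (negbTE (neq ru)).
  have p3 : packs e [set:: [:: p; q; r]] 1.
    by apply: (@packs_P3 _ _ _ p q r); rewrite // !inE eqxx ?orbT.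
  have : 4 * (1 + 2) < #|[set:: [:: p; q; r]] :|: (u |: S)|.
    apply: (min_closed_packs); last exact: packsU.
    - rewrite !subUset sub1set (inA up) SA !andbT.
      by apply: seq_subA; rewrite /= (inA pq) (inA qr) (inA rv).
    - by apply/set0Pn; exists p; rewrite !inE eqxx.
    - apply/closed_setP => a b; rewrite !inE => /orP[/or3P[]/eqP->|/orP[/eqP->|aS]] ab.
      + by move: ab; rewrite Np => /orP[]->; rewrite ?orbT.
      + by move: ab; rewrite Nq => /orP[]->; rewrite ?orbT.
      + by move: ab; rewrite Nr => /orP[]->; rewrite ?orbT.
      + by move: ab; rewrite Nu => /or3P[->|->|/eqP->]; rewrite ?uS ?orbT.
      + case: (boolP (b \in S)) => bS; rewrite ?orbT //.
        by have [_ ->] := out _ _ aS bS ab; rewrite eqxx ?orbT.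
  apply/negP; rewrite -leqNgt; apply: leq_trans (leq_card_setU _ _).1 _.
  rewrite cardsU1 S5; have := cards_seq_le [:: p; q; r]; have := leq_b1 (u \notin S).
  by rewrite /=; clear; lia.
have vu : e v u by rewrite sy.
have Nq' x : e q x = (x == r) || (x == p) by rewrite Nq orbC.
have vneq : v != r by rewrite eq_sym neq.
have [du|du] := min_deg23 up; have [dv|dv] := min_deg23 vr.
- have [a ap Nu] := deg2P du up; have [b br Nv] := deg2P dv vr.
  have Ea : a = v by move: uv; rewrite Nu (negbTE vp) => /eqP->.
  have Eb : b = u by move: vu; rewrite Nv (negbTE ur) => /eqP->.
  subst a b; exfalso; apply: (closed_le5 (Q := [set:: [:: p; q; r; u; v]])).
  - by apply: seq_subA; rewrite /= (inA pq) (inA qr) (inA rv) (inA uv) (inA vr).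
  - by apply/set0Pn; exists p; rewrite !inE eqxx.
  - apply/closed_setP => x y; rewrite !inE => /or4P[/eqP->|/eqP->|/eqP->|/orP[]/eqP->];
    rewrite ?Np ?Nq ?Nr ?Nu ?Nv => /orP[]/eqP->; by rewrite eqxx ?orbT.
  - exact: leq_trans (cards_seq_le _) _.
- have [a ap Nu] := deg2P du up.
  have Ea : a = v by move: uv; rewrite Nu (negbTE vp) => /eqP->.
  subst a; have [y py] := pendant_C5 Np Nq Nr Nu dv uq vq pr ur.
  by exists [set:: [:: p; q; r; u; v]], v, y; split=> //; rewrite !inE eqxx orbT.
- have [b br Nv] := deg2P dv vr.
  have Eb : b = u by move: vu; rewrite Nv (negbTE ur) => /eqP->.
  have rp : r != p by rewrite eq_sym.
  subst b; have [y py] := pendant_C5 Nr Nq' Np Nv du vq uq rp vp.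
  by exists [set:: [:: r; q; p; v; u]], u, y; split=> //; rewrite !inE eqxx orbT.
(* [u] and [v] stay connected through [p q r], so the edge between them is no bridge. *)
exfalso; have [S [pS|pS]] := delete_edge uv du dv; case: (pS) => SA S5 xS yS [_ out].
  have inS a b : a \in S -> e a b -> b != v -> b \in S.
    by move=> aS ab; apply: contraNT => bS; have [_ ->] := out _ _ aS bS ab.
  have pS' : p \in S by apply: (inS u); rewrite // eq_sym.
  have qS' : q \in S by apply: (inS p); rewrite // eq_sym.
  have rS' : r \in S by apply: (inS q); rewrite // eq_sym.
  by have [E _] := out _ _ rS' yS rv; rewrite E eqxx in ur.
have inS a b : a \in S -> e a b -> b != u -> b \in S.
  by move=> aS ab; apply: contraNT => bS; have [_ ->] := out _ _ aS bS ab.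
have rS' : r \in S by apply: (inS v); rewrite // eq_sym.
have qS' : q \in S by apply: (inS r); rewrite // eq_sym.
have pS' : p \in S by apply: (inS q); rewrite // neq.
by have [E _] := out _ _ pS' yS pu; rewrite E eqxx in vp.
Qed.

(** * Claws with three leaves of degree 2 *)

Section Claw.
Variables (c m1 m2 m3 c1 c2 c3 : T).
Hypotheses (Nc : forall x, e c x = [|| x == m1, x == m2 | x == m3])
  (N1 : forall x, e m1 x = (x == c) || (x == c1)) (N2 : forall x, e m2 x = (x == c) || (x == c2))
  (N3 : forall x, e m3 x = (x == c) || (x == c3))
  (m12 : m1 != m2) (m13 : m1 != m3) (m23 : m2 != m3)
  (d1 : deg e m1 = 2) (d2 : deg e m2 = 2) (d3 : deg e m3 = 2)
  (dc1 : deg e c1 = 3) (dc2 : deg e c2 = 3) (dc3 : deg e c3 = 3).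

Let cm1 : e c m1. Proof. by rewrite Nc eqxx. Qed.
Let cm2 : e c m2. Proof. by rewrite Nc eqxx orbT. Qed.
Let cm3 : e c m3. Proof. by rewrite Nc eqxx !orbT. Qed.
Let mc1 : e m1 c1. Proof. by rewrite N1 eqxx orbT. Qed.
Let mc2 : e m2 c2. Proof. by rewrite N2 eqxx orbT. Qed.
Let mc3 : e m3 c3. Proof. by rewrite N3 eqxx orbT. Qed.
Let d23 x y : deg e x = 2 -> deg e y = 3 -> x != y.
Proof. by move=> dx dy; apply/eqP => E; rewrite E dy in dx. Qed.
Let cA : c \in A. Proof. exact: inA cm1. Qed.

(* The 4-cycle [c m1 c1 m2] is contracted to an edge between [m3] and [z]. *)
Lemma no_double_claw : c1 = c2 -> c1 != c -> c3 != c1 -> c3 != c -> False.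
Proof.
move=> E c1c c31 c3c.
have mc2' : e m2 c1 by rewrite E.
have N2' x : e m2 x = (x == c) || (x == c1) by rewrite E.
have c1m1 : e c1 m1 by rewrite sy.
have c1m2 : e c1 m2 by rewrite sy.
have [z [zm1 zm2 Nc1]] := deg3P2 dc1 c1m1 c1m2 m12.
have c1z : e c1 z by rewrite Nc1 eqxx !orbT.
have zm3 : z != m3.
  by apply: contraTneq c1z => ->; rewrite sy N3 negb_or c1c eq_sym.
have zc : z != c.
  apply: contraTneq c1z => ->; rewrite sy Nc !negb_or.
  by rewrite ![c1 == _]eq_sym !d23.
(* Otherwise [z = c3], and the edge [c1 c3] would be a bridge although [c1 m1 c m3 c3] goes around
   it. *)
have nm3z : ~~ e m3 z.
  rewrite N3 negb_or zc /=; apply/eqP => Ez; subst z.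
  have [S [pS|pS]] := delete_edge c1z dc1 dc3; case: pS => SA S5 xS yS [_ out].
    have inS a b : a \in S -> e a b -> b != c3 -> b \in S.
      by move=> aS ab; apply: contraNT => bS; have [_ ->] := out _ _ aS bS ab.
    have mS : m1 \in S by apply: (inS c1); rewrite // d23.
    have cS : c \in S by apply: (inS m1); rewrite 1?sy // eq_sym.
    have m3S : m3 \in S by apply: (inS c); rewrite // d23.
    by have [E3 _] := out _ _ m3S yS mc3; move: (d23 d3 dc1); rewrite E3 eqxx.
  have inS a b : a \in S -> e a b -> b != c1 -> b \in S.
    by move=> aS ab; apply: contraNT => bS; have [_ ->] := out _ _ aS bS ab.
  have m3S : m3 \in S by apply: (inS c3); rewrite 1?sy // d23.
  have cS : c \in S by apply: (inS m3); rewrite 1?sy // eq_sym.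
  have mS : m1 \in S by apply: (inS c); rewrite // d23.
  by have [E3 _] := out _ _ mS yS mc1; move: (d23 d1 dc3); rewrite E3 eqxx.
set Q := [set:: [:: c; m1; m2; c1]].
have cQ : c \in Q by rewrite !inE eqxx.
have c1Q : c1 \in Q by rewrite !inE eqxx !orbT.
have m3Q : m3 \notin Q.
  by rewrite !inE !negb_or ![m3 == _]eq_sym m13 m23 neq // eq_sym d23.
have zQ : z \notin Q.
  by rewrite !inE !negb_or zc zm1 zm2 /= eq_sym neq.
have QA : Q \subset A.
  by apply: seq_subA; rewrite /= cA (inA mc1) (inA mc2) (inA c1m1).
have Q4 : #|Q| <= 4 := cards_seq_le _.
have m3z : m3 != z by rewrite eq_sym.
have [] := @min_link Q c c1 m3 z Q4 QA cQ c1Q m3Q zQ m3z nm3z cm3 c1z.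
- move=> a b; rewrite !inE => /or4P[]/eqP-> /norP[bc /norP[b1 /norP[b2 b3]]].
  + by rewrite Nc (negbTE b1) (negbTE b2) => /eqP->; left.
  + by rewrite N1 (negbTE bc) (negbTE b3).
  + by rewrite N2' (negbTE bc) (negbTE b3).
  + by rewrite Nc1 (negbTE b1) (negbTE b2) => /eqP->; right.
- by apply: (@packs_P3 _ _ _ c m1 c1); rewrite ?inE ?eqxx ?orbT // 1?sy // eq_sym.
- apply: (@packs_P3 _ _ _ m1 c1 m2); rewrite ?inE ?eqxx ?orbT //.
  + by rewrite [m1 == c]eq_sym neq ?orbT.
  + by rewrite c1c !orbT.
  + by rewrite [m2 == c]eq_sym neq ?orbT.
- apply: (@packs_P3 _ _ _ m1 c m2); rewrite ?inE ?eqxx ?orbT //.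
  + by rewrite d23 ?orbT.
  + by rewrite [c == c1]eq_sym c1c !orbT.
  + by rewrite d23 ?orbT.
move=> _ grL dL [S [SK m3S zS]].
have dL2 : deg (link Q m3 z) m3 <= 2 by rewrite dL d3.
have c3Q : c3 \notin Q.
  by rewrite !inE !negb_or c3c c31 ![c3 == _]eq_sym !d23.
have l3 : link Q m3 z m3 c3 by rewrite /link /avoid mc3 m3Q c3Q.
have core := closed5_core grL SK m3S dL2 l3.
move: SK; rewrite inE => /and3P[/subsetP SA /eqP S5 /closed_setP cS].
have SQ x : x \in S -> x \notin Q by move/SA/setDP => [].
have SA' : S \subset A by apply/subsetP => x /SA/setDP[].
have c3S := cS _ _ m3S l3.
(* Both exits [m3] and [z] of [Q] lie in [S], so the union is closed. It has at most nine vertices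
   and holds [c m3 c3], [m1 c1 m2] and a path in the rest of [S], which avoids [m3] and hence the
   new edge. *)
have : 4 * (1 + 1 + 1) < #|Q :|: S|.
  apply: (min_closed_packs).
  - by rewrite subUset QA.
  - by apply/set0Pn; exists c; rewrite inE cQ.
  - apply/closed_setP => a b /setUP[aQ|aS] ab; rewrite inE; case: (boolP (b \in Q)) => //= bQ.
      move: aQ bQ; rewrite !inE => /or4P[]/eqP Ea; subst a;
        move=> /norP[bc /norP[b1 /norP[b2 b3]]]; move: ab.
      + by rewrite Nc (negbTE b1) (negbTE b2) => /eqP->.
      + by rewrite N1 (negbTE bc) (negbTE b3).
      + by rewrite N2' (negbTE bc) (negbTE b3).
      + by rewrite Nc1 (negbTE b1) (negbTE b2) => /eqP->.
    by apply: (cS a) => //; rewrite /link /avoid ab bQ SQ.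
  have sub : [set:: [:: c; m3; c3]] :|: [set:: [:: m1; c1; m2]] :|: (S :\ m3 :\ c3)
      \subset Q :|: S.
    apply/subsetP => x; rewrite !inE -!orbA.
    by case/or4P=> [/eqP->|/eqP->|/eqP->|/or4P[/eqP->|/eqP->|/eqP->|/and3P[_ _ ->]]];
      rewrite ?eqxx ?m3S ?c3S ?orbT.
  apply: packs_subset sub _; apply: packsU.
  - rewrite -setI_eq0; apply/eqP/setP => x; rewrite !inE; apply/negP => /and4P[h x1 x2 xS].
    have := SQ x xS; rewrite !inE !negb_or => /and4P[n1 n2 n3 n4]; move: h.
    by rewrite (negbTE n1) (negbTE n2) (negbTE n3) (negbTE n4) (negbTE x1) (negbTE x2).
  - apply: packsU.
    + rewrite -setI_eq0; apply/eqP/setP => x; rewrite !inE; apply/negP => /andP[h].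
      have nm31 : m3 != m1 by rewrite eq_sym.
      have nm32 : m3 != m2 by rewrite eq_sym.
      have cc1 : c != c1 by rewrite eq_sym.
      case/or3P: h => /eqP->; rewrite ?(negbTE (neq cm1)) ?(negbTE (neq cm2)) ?(negbTE cc1) //.
        by rewrite (negbTE nm31) (negbTE nm32) (negbTE (d23 d3 dc1)).
      rewrite ![c3 == m1]eq_sym [c3 == m2]eq_sym (negbTE c31).
      by rewrite (negbTE (d23 d1 dc3)) (negbTE (d23 d2 dc3)).
    + by apply: (@packs_P3 _ _ _ c m3 c3); rewrite ?inE ?eqxx ?orbT // 1?sy // eq_sym.
    + by apply: (@packs_P3 _ _ _ m1 c1 m2); rewrite ?inE ?eqxx ?orbT.
  - apply: packs_subrel core => x y; rewrite !inE => /and3P[_ x3 _] /and3P[_ y3 _].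
    by rewrite /link (negbTE x3) (negbTE y3) !andbF !orbF => /and3P[].
apply/negP; rewrite -leqNgt; apply: leq_trans (leq_card_setU _ _).1 _.
by rewrite S5; clear -Q4; lia.
Qed.

Hypotheses (c12 : c1 != c2) (c13 : c1 != c3) (c23 : c2 != c3).

Definition claw := [set:: [:: c; m1; m2; m3]].

Lemma claw_out q x : q \in claw -> x \notin claw -> e q x ->
  [\/ q = m1 /\ x = c1, q = m2 /\ x = c2 | q = m3 /\ x = c3].
Proof.
rewrite !inE => /or4P[]/eqP-> /norP[bc /norP[b1 /norP[b2 b3]]].
- by rewrite Nc (negbTE b1) (negbTE b2) (negbTE b3).
- by rewrite N1 (negbTE bc) => /eqP->; constructor 1.
- by rewrite N2 (negbTE bc) => /eqP->; constructor 2.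
- by rewrite N3 (negbTE bc) => /eqP->; constructor 3.
Qed.

Lemma claw_touch q x : q \in claw -> x \notin claw -> e q x ->
  deg e x = 3 /\ forall q', q' \in claw -> e q' x -> q' = q.
Proof.
move=> qQ xQ qx; split.
  by case: (claw_out qQ xQ qx) => -[_ ->].
move=> q' q'Q q'x; case: (claw_out qQ xQ qx) => -[-> Ex]; subst x;
case: (claw_out q'Q xQ q'x) => -[-> E] //; move: c12 c13 c23;
by rewrite E eqxx.
Qed.

Lemma claw_sub : claw \subset A.
Proof. by apply: seq_subA; rewrite /= cA (inA mc1) (inA mc2) (inA mc3). Qed.

(* If removing the claw leaves a component [S] with five vertices, then the claw and [S]
   together contain three paths, so removing their union is a valid reduction. *)
Lemma claw_no_closed5 S : S \in closed5 (A :\: claw) (avoid e claw) -> c1 \in S -> False.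
Proof.
move=> SK c1S; have gr' := avoid_graph gr claw_touch.
have m1Q : m1 \in claw by rewrite !inE eqxx orbT.
have c1A : c1 \in A := inA' mc1.
have [s [_ [_ c1s _]]] : exists a b, [/\ a != b, avoid e claw c1 a & avoid e claw c1 b].
  apply: (graph_nbr2 gr'); move: SK; rewrite inE => /and3P[/subsetP SA _ _]; exact: SA.
have dL : deg (avoid e claw) c1 <= 2.
  have : deg (avoid e claw) c1 < deg e c1; last by rewrite dc1.
  apply: proper_card; apply/properP; split.
    by apply/subsetP => y; rewrite !inE => /and3P[].
  by exists m1; rewrite !inE ?[e c1 m1]sy // /avoid m1Q /= !andbF.
have core := closed5_core gr' SK c1S dL c1s.
move: SK; rewrite inE => /and3P[/subsetP SA /eqP S5 /closed_setP cS].
have sS := cS _ _ c1S c1s.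
have SQ x : x \in S -> x \notin claw by move/SA/setDP => [].
have SA' : S \subset A by apply/subsetP => x /SA/setDP[].
have inS a b : a \in S -> e a b -> b \notin claw -> b \in S.
  by move=> aS ab bQ; apply: (cS a) => //; rewrite /avoid ab bQ SQ.
have Q4 : #|claw| <= 4 := cards_seq_le _.
(* The paths are [m1 c1 s], [m2 c m3] and one from [core]. Only [c2] and [c3] can be outer
   neighbours, so [12 < 9 + 2] would follow. *)
have : 4 * (1 + 1 + 1) < #|claw :|: S| + #|[set:: [:: c2; c3]]|.
  apply: (min_remove).
  - by rewrite subUset claw_sub.
  - by apply/set0Pn; exists s; rewrite inE sS orbT.
  - have sub : [set:: [:: m1; c1; s]] :|: [set:: [:: m2; c; m3]] :|: (S :\ c1 :\ s)
        \subset claw :|: S.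
      apply/subsetP => x; rewrite !inE -!orbA.
      by case/or4P=> [/eqP->|/eqP->|/eqP->|/or4P[/eqP->|/eqP->|/eqP->|/and3P[_ _ ->]]];
        rewrite ?eqxx ?c1S ?sS ?orbT.
    apply: packs_subset sub _; apply: packsU.
    + rewrite -setI_eq0; apply/eqP/setP => x; rewrite !inE; apply/negP => /and4P[h x1 x2 xS].
      have := SQ x xS; rewrite !inE !negb_or => /and4P[n1 n2 n3 n4]; move: h.
      by rewrite (negbTE n1) (negbTE n2) (negbTE n3) (negbTE n4) (negbTE x1) (negbTE x2).
    + have nc x : x \in S -> (x == m2) || ((x == c) || (x == m3)) = false.
        move/SQ; rewrite !inE !negb_or => /and4P[n1 _ n2 n3].
        by rewrite (negbTE n1) (negbTE n2) (negbTE n3).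
      apply: packsU.
      * rewrite -setI_eq0; apply/eqP/setP => x; rewrite !inE; apply/negP => /andP[h].
        case/or3P: h => /eqP->; [|by rewrite nc|by rewrite nc].
        by rewrite (negbTE m12) (negbTE m13) eq_sym (negbTE (neq cm1)).
      * apply: (@packs_P3 _ _ _ m1 c1 s); rewrite ?inE ?eqxx ?orbT // 1?sy //.
          by apply: contraTneq sS => <-; apply/negP => /SQ; rewrite m1Q.
        by rewrite sy; case/and3P: c1s.
      * by apply: (@packs_P3 _ _ _ m2 c m3); rewrite ?inE ?eqxx ?orbT.
    + by apply: packs_subrel core => x y _ _ /and3P[].
  - have outQ q x : q \in claw :|: S -> x \notin claw :|: S -> e q x ->
        (q = m2 /\ x = c2) \/ (q = m3 /\ x = c3).
      rewrite !in_setU => /orP[qQ|qS] /norP[xQ xS] qx.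
        case: (claw_out qQ xQ qx) => -[-> Ex]; [|by left|by right].
        by rewrite Ex c1S in xS.
      by rewrite (inS q x) in xS.
    move=> q x qQ xQ qx; split.
    + by case: (outQ _ _ qQ xQ qx) => -[_ ->]; rewrite !inE eqxx ?orbT.
    + by case: (outQ _ _ qQ xQ qx) => -[_ ->].
    + move=> q' q'Q q'x; case: (outQ _ _ qQ xQ qx) => -[-> Ex]; subst x;
      case: (outQ _ _ q'Q xQ q'x) => -[-> E] //; move: c23;
      by rewrite E eqxx.
apply/negP; rewrite -leqNgt; apply: leq_trans (leq_add (leq_card_setU _ _).1 (cards_seq_le _)) _.
by rewrite S5 /=; clear -Q4; lia.
Qed.
End Claw.

(** If the three far vertices coincide, the graph has a component [K_{2,3}] with five vertices; two
    coinciding ones give the double claw. If they are distinct, removing the claw trades four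
    vertices for one path, so it must create a closed 5-set, which contains one of them. *)
Lemma no_claw c : deg e c = 3 ->
  (forall m, e c m -> deg e m = 2 /\ forall x, e m x -> deg e x = 3) -> False.
Proof.
move=> dc h.
have [m1 cm1] : exists m, e c m.
  have /card_gt0P[m cm] : 0 < deg e c by rewrite dc.
  by exists m; move: cm; rewrite inE.
have [m2 [m3 [m21 m31 m23 Nc]]] := deg3P dc cm1.
have cm2 : e c m2 by rewrite Nc eqxx orbT.
have cm3 : e c m3 by rewrite Nc eqxx !orbT.
have mid m : e c m -> exists d, [/\ d != c, deg e d = 3, deg e m = 2 &
    forall x, e m x = (x == c) || (x == d)].
  move=> cm; have [dm hm] := h m cm; have mc' : e m c by rewrite sy.
  have [d dc' Nm] := deg2P dm mc'; exists d; split=> //.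
  by apply: hm; rewrite Nm eqxx orbT.
have [c1 [c1c dc1 d1 N1]] := mid _ cm1; have [c2 [c2c dc2 d2 N2]] := mid _ cm2.
have [c3 [c3c dc3 d3 N3]] := mid _ cm3.
have m12 : m1 != m2 by rewrite eq_sym.
have m13 : m1 != m3 by rewrite eq_sym.
have m32 : m3 != m2 by rewrite eq_sym.
have Nc2 x : e c x = [|| x == m2, x == m1 | x == m3] by rewrite Nc orbCA.
have Nc3 x : e c x = [|| x == m3, x == m1 | x == m2] by rewrite Nc orbA orbC.
have Nc1' x : e c x = [|| x == m1, x == m3 | x == m2] by rewrite Nc [(x == m2) || _]orbC.
have Nc2' x : e c x = [|| x == m2, x == m3 | x == m1] by rewrite Nc orbC orbA.
have [E12|c12] := eqVneq c1 c2.
  have [E13|c31] := eqVneq c3 c1; last first.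
    exact: (no_double_claw Nc N1 N2 N3).
  subst c2 c3; apply: (closed_le5 (Q := [set:: [:: c; m1; m2; m3; c1]])).
  - apply: seq_subA; rewrite /= (inA cm1) (inA' cm1) (inA' cm2) (inA' cm3) /= andbT.
    by apply: (@inA' m1); rewrite N1 eqxx orbT.
  - by apply/set0Pn; exists c; rewrite !inE eqxx.
  - have c1m1 : e c1 m1 by rewrite sy N1 eqxx orbT.
    have c1m2 : e c1 m2 by rewrite sy N2 eqxx orbT.
    have [z [zm1 zm2 Nc1]] := deg3P2 dc1 c1m1 c1m2 m12.
    have c1m3 : e c1 m3 by rewrite sy N3 eqxx orbT.
    have Ez : z = m3.
      by move: c1m3; rewrite Nc1 (negbTE m31) (negbTE m32) => /eqP->.
    subst z; apply/closed_setP => x y; rewrite !inE => /or4P[/eqP->|/eqP->|/eqP->|/orP[]/eqP->];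
    rewrite ?Nc ?N1 ?N2 ?N3 ?Nc1; by [case/or3P=> ->; rewrite ?orbT|case/orP=> ->; rewrite ?orbT].
  - exact: leq_trans (cards_seq_le _) _.
have [E13|c13] := eqVneq c1 c3.
  have c21 : c2 != c1 by rewrite eq_sym.
  exact: (no_double_claw Nc1' N1 N3 N2).
have [E23|c23] := eqVneq c2 c3.
  exact: (no_double_claw Nc2' N2 N3 N1).
have c21 : c2 != c1 by rewrite eq_sym.
have c31 : c3 != c1 by rewrite eq_sym.
have c32 : c3 != c2 by rewrite eq_sym.
have touch := claw_touch Nc N1 N2 N3 dc1 dc2 dc3 c12 c13 c23.
have sub := claw_sub Nc N1 N2 N3.
have p1 : packs e (claw c m1 m2 m3) 1.
  by apply: (@packs_P3 _ _ _ m1 c m2); rewrite ?inE ?eqxx ?orbT.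
have Q0 : claw c m1 m2 m3 != set0 by apply/set0Pn; exists c; rewrite !inE eqxx.
have lt := min_remove_closed5 sub Q0 p1 touch.
have Q4 : #|claw c m1 m2 m3| <= 4 := cards_seq_le _.
have /card_gt0P[S SK] : 0 < #|closed5 (A :\: claw c m1 m2 m3) (avoid e (claw c m1 m2 m3))|.
  by clear -lt Q4; lia.
have [q [x [qQ xS xQ qx]]] := closed5_avoid SK.
have E2 : claw c m1 m2 m3 = claw c m2 m1 m3.
  by apply/setP => y; rewrite !inE; congr (_ || _); rewrite orbCA.
have E3 : claw c m1 m2 m3 = claw c m3 m1 m2.
  by apply/setP => y; rewrite !inE; congr (_ || _); rewrite orbA orbC.
case: (claw_out Nc N1 N2 N3 qQ xQ qx) => -[_ Ex]; subst x.
- exact: (claw_no_closed5 Nc N1 N2 N3 m12 m13 m23 dc1 dc2 dc3 c12 c13 c23 SK).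
- rewrite E2 in SK.
  exact: (claw_no_closed5 Nc2 N2 N1 N3 m21 m23 m13 dc2 dc1 dc3 c21 c23 c13 SK).
- rewrite E3 in SK.
  exact: (claw_no_closed5 Nc3 N3 N1 N2 m31 m32 m12 dc3 dc1 dc2 c31 c32 c12 SK).
Qed.

(** * The packing around the vertices of degree 3 *)

Definition pendants := [set S : {set T} | [exists t, exists w,
  [&& S \subset A, #|S| == 5, t \in S, w \notin S, e t w &
    [forall x in S, forall y, (y \notin S) ==> e x y ==> (x == t) && (y == w)]]]].

Lemma pendantsP S : reflect (exists t w, pendant S t w) (S \in pendants).
Proof.
rewrite inE; apply: (iffP existsP) => -[t].
  move=> /existsP[w /and5P[SA /eqP S5 tS wS /andP[tw /forall_inP out]]].
  exists t, w; split=> //; split=> // x y xS yS xy.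
  by move: (forallP (out x xS) y); rewrite yS xy => /andP[/eqP-> /eqP->].
move=> [w [SA S5 tS wS [tw out]]]; exists t; apply/existsP; exists w.
rewrite SA S5 eqxx tS wS tw; apply/forall_inP => x xS; apply/forallP => y.
by apply/implyP => yS; apply/implyP => xy; have [-> ->] := out _ _ xS yS xy; rewrite !eqxx.
Qed.

(* For a pendant set this is [S :\ t], without reference to the choice of [t]. *)
Definition interior S := [set x in S | [forall y, e x y ==> (y \in S)]].

Lemma interiorP S x : reflect (x \in S /\ forall y, e x y -> y \in S) (x \in interior S).
Proof.
rewrite inE; apply: (iffP andP) => -[xS h]; split=> //.
  by move=> y; apply/implyP/(forallP h).
by apply/forallP => y; apply/implyP/h.
Qed.

Lemma interior_pendant S t w : pendant S t w -> interior S = S :\ t.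
Proof.
move=> [_ _ tS wS [tw out]]; apply/setP => x; rewrite in_setD1.
apply/interiorP/andP => [[xS h]|[xt xS]]; split=> //.
  by apply/eqP => E; subst x; rewrite (h w tw) in wS.
by move=> y xy; apply: contraNT xt => yS; have [->] := out _ _ xS yS xy.
Qed.

Lemma minimal_counterexample_false : False.
Proof.
pose U := cover pendants.
have inU S t w x : pendant S t w -> x \in S -> x \in U.
  by move=> pS xS; apply/bigcupP; exists S => //; apply/pendantsP; exists t, w.
pose C := [set c in A | (deg e c == 3) && (c \notin U)].
(* Vertices of degree 2 whose neighbours both have degree 3; each is given up by one of the two. *)
pose M := [set m in A | [&& m \notin U, deg e m == 2 & [forall x, e m x ==> (deg e x == 3)]]].
have MP m : m \in M -> [/\ m \notin U, deg e m = 2 & forall x, e m x -> deg e x = 3].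
  rewrite inE => /and4P[_ mU /eqP dm /forallP h]; split=> // x mx.
  by apply/eqP; move: (h x); rewrite mx.
have CP c : c \in C -> deg e c = 3 /\ c \notin U.
  by rewrite inE => /and3P[_ /eqP].
(* [g m] is the neighbour of [m] that gives up [m]. *)
have [g [gN gi]] : exists g : T -> T, {in M, forall m, g m \in nbrs e m} /\ {in M &, injective g}.
  apply: sdr_of_pairs => [m /MP[_ dm _]|v|].
  - by rewrite -card_gt0 -[#|_|]/(deg e m) dm.
  - have sub : [set m in M | v \in nbrs e m] \subset nbrs e v.
      by apply/subsetP => m; rewrite !inE sy => /andP[].
    (* Three members of [M] around [v] would be all its neighbours, which [no_claw] excludes. *)
    rewrite leqNgt; apply/negP => gt2.
    have [m] : exists m, m \in [set m in M | v \in nbrs e m].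
      by apply/card_gt0P; apply: leq_trans gt2.
    rewrite in_set => /andP[mM]; rewrite inE => mv.
    have dv : deg e v = 3 by case: (MP m mM) => _ _; apply.
    have /eqP E : [set m in M | v \in nbrs e m] == nbrs e v.
      by rewrite eqEcard sub -[#|nbrs e v|]/(deg e v) dv.
    apply: (no_claw dv) => m' vm'.
    have : m' \in [set m in M | v \in nbrs e m] by rewrite E inE.
    by rewrite in_set => /andP[/MP[_ ? ?] _].
  - suff -> : [set m in M | #|nbrs e m| == 1] = set0 by rewrite cards0.
    apply/setP => m; rewrite in_set0 in_set; apply/andP => -[/MP[_ dm _]].
    by rewrite -[#|_|]/(deg e m) dm.
pose L c := nbrs e c :\: [set m in M | g m == c].
pose D c := c |: L c.
have LP c x : x \in L c -> e c x /\ (x \in M -> g x != c).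
  by rewrite !in_setD !in_set negb_and => /andP[/orP[/negbTE->|h] xc].
have adjC c c' : e c c' -> c \notin U -> c' \notin U -> deg e c = 3 -> deg e c' = 3 -> False.
  move=> cc' cU c'U dc dc'; have [S [pS|pS]] := delete_edge cc' dc dc'.
    by case/negP: cU; apply: (inU _ _ _ _ pS); case: pS.
  by case/negP: c'U; apply: (inU _ _ _ _ pS); case: pS.
have pC c : c \in C -> packs e (D c) 1.
  move=> /CP[dc cU].
  have : 1 < #|L c|.
    (* As [g] is injective on [M], at most one of the three neighbours is given up. *)
    have : #|nbrs e c :&: [set m in M | g m == c]| <= 1.
      apply/card_le1_eqP => x y /setIP[_]; rewrite in_set => /andP[xM /eqP xc].
      move=> /setIP[_]; rewrite in_set => /andP[yM /eqP yc].
      by apply: gi => //; rewrite xc yc.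
    have := cardsID [set m in M | g m == c] (nbrs e c).
    rewrite -[#|nbrs e c|]/(deg e c) dc /L; clear; lia.
  move=> /card_gt1P[a [b [aL bL ab]]]; have [ca _] := LP _ _ aL; have [cb _] := LP _ _ bL.
  by apply: (@packs_P3 _ _ _ a c b) => //; rewrite in_setU1 ?eqxx ?aL ?bL ?orbT.
have dC c c' : c \in C -> c' \in C -> c != c' -> [disjoint D c & D c'].
  move=> cC c'C ne; have [dc cU] := CP _ cC; have [dc' c'U] := CP _ c'C.
  rewrite -setI_eq0; apply/eqP/setP => x; rewrite in_set0 in_setI !in_setU1; apply/negP.
  case/andP=> [/orP[/eqP->|xL] /orP[/eqP E|xL']].
  - by rewrite E eqxx in ne.
  - by have [c'c _] := LP _ _ xL'; apply: (adjC c' c).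
  - by subst x; have [cc' _] := LP _ _ xL; apply: (adjC c c').
  (* A common neighbour [x] is outside [U], since one outgoing edge cannot lead to both centres. So
     it has degree 2 and lies in [M], and the centre [g x] has given it up. *)
  have [cx gc] := LP _ _ xL; have [c'x gc'] := LP _ _ xL'.
  have xc : e x c by rewrite sy.
  have xc' : e x c' by rewrite sy.
  have xU : x \notin U.
    apply/negP => /bigcupP[S /pendantsP[t [w pS]] xS]; have inS := inU _ _ _ _ pS.
    case: (pS) => _ _ _ _ [_ out].
    have [_ E] := out _ _ xS (contra (inS c) cU) xc.
    have [_ E'] := out _ _ xS (contra (inS c') c'U) xc'.
    by rewrite E E' eqxx in ne.
  have [dx|dx] := min_deg23 xc; last exact: (adjC c x).
  have [b bc Nx] := deg2P dx xc.
  have Eb : b = c' by move: xc'; rewrite Nx eq_sym (negbTE ne) => /eqP->.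
  have xM : x \in M.
    rewrite in_set (inA xc) xU dx /=; apply/forallP => y; apply/implyP.
    by rewrite Nx Eb => /orP[]/eqP->; rewrite ?dc ?dc'.
  have := gN x xM; rewrite inE Nx Eb => /orP[]; [exact/negP/gc|exact/negP/gc'].
have pS S : S \in pendants -> packs e (interior S) 1.
  by move=> /pendantsP[t [w pS]]; rewrite (interior_pendant pS); apply: (pendant_packs pS).
have dS S S' : S \in pendants -> S' \in pendants -> S != S' -> [disjoint interior S & interior S'].
  move=> /pendantsP[t [w p1]] /pendantsP[t' [w' p2]] ne.
  apply: disjointWl (disjointWr _ (pendant_disjoint p1 p2 ne));
  by apply/subsetP => x /interiorP[].
(* All neighbours of an interior vertex lie in its pendant set, hence in [U], whereas centres are
   outside [U]. *)
have dCS : [disjoint \bigcup_(c in C) D c & \bigcup_(S in pendants) interior S].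
  rewrite -setI_eq0; apply/eqP/setP => x; rewrite in_set0 in_setI; apply/negP.
  case/andP=> /bigcupP[c /CP[_ cU] xD] /bigcupP[S Spend /interiorP[xS h]].
  case/negP: cU; apply/bigcupP; exists S => //.
  by move: xD; rewrite in_setU1 => /orP[/eqP<-//|/LP[cx _]]; apply: h; rewrite sy.
have pA := packsU dCS (packs_bigcup pC dC) (packs_bigcup pS dS).
have lt : 4 * (#|C| + #|pendants|) < #|A|.
  apply: (mc_packs mc); apply: packs_subset pA; rewrite subUset; apply/andP; split.
    apply/bigcupsP => c cC; apply/subsetP => x; rewrite in_setU1 => /orP[/eqP->|/LP[/inA']//].
    by move: cC; rewrite inE => /andP[].
  apply/bigcupsP => S /pendantsP[t [w [/subsetP SA _ _ _ _]]].
  by apply/subsetP => x /interiorP[/SA].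
(* The cover uses full closed neighbourhoods, including the vertices given up; these have four
   elements, like the interiors. *)
have cover : A \subset \bigcup_(c in C) (c |: nbrs e c) :|: \bigcup_(S in pendants) interior S.
  apply/subsetP => x xA; rewrite in_setU; apply/orP.
  have starC c : c \in C -> e c x -> x \in \bigcup_(c in C) (c |: nbrs e c).
    by move=> cC cx; apply/bigcupP; exists c => //; rewrite !inE cx orbT.
  have [xU|xU] := boolP (x \in U).
    have /bigcupP[S Sp xS] := xU; have /pendantsP[t [w p1]] := Sp.
    have [E|xt] := eqVneq x t; last first.
      by right; apply/bigcupP; exists S; rewrite ?(interior_pendant p1) ?in_setD1 ?xt.
    (* The vertex [t] is covered by [w], which is a centre: it has degree 3 and lies in no pendant
       set. *)
    have dw := pendant_deg3 p1; case: (p1) => _ _ _ _ [tw _].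
    left; apply: (starC w); last by rewrite E sy.
    rewrite inE (inA' tw) dw eqxx /=; apply/bigcupP => -[S' /pendantsP[t' [w' p2]]].
    exact/negP/(pendant_far_end p1 p2).
  left; have /andP[dx _] := degA xA; have [a [b [ab xa xb]]] := graph_nbr2 gr xA.
  have [d2|d3] := min_deg23 xa; last first.
    by apply/bigcupP; exists x; rewrite ?inE ?eqxx // xA d3 xU.
  (* If [y] were in a pendant set, [x] would be its far end and have degree 3. *)
  have nb y : e x y -> deg e y = 3 -> x \in \bigcup_(c in C) (c |: nbrs e c).
    move=> xy dy; apply: (starC y); last by rewrite sy.
    rewrite inE (inA' xy) dy eqxx /=; apply: contraNN xU => /bigcupP[S Sp yS].
    have /pendantsP[t [w p1]] := Sp; apply: contraT => xU.
    have [_ _ _ _ [_ out]] := p1.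
    have yx : e y x by rewrite sy.
    have [_ E] := out _ _ yS (contra (inU _ _ _ _ p1) xU) yx.
    by have := pendant_deg3 p1; rewrite -E d2.
  have ax : e a x by rewrite sy.
  have bx : e b x by rewrite sy.
  have [da|da] := min_deg23 ax; last exact: nb da.
  have [db|db] := min_deg23 bx; last exact: nb db.
  have [S [t [w [p1 xS]]]] := deg2_middle_pendant da d2 db xa xb ab.
  by rewrite (inU _ _ _ _ p1 xS) in xU.
have := leq_trans (subset_leq_card cover) (leq_card_setU _ _).1.
have c1 : #|\bigcup_(c in C) (c |: nbrs e c)| <= 4 * #|C|.
  apply: card_bigcup_le => c /CP[dc _]; rewrite cardsU1 -[#|nbrs e c|]/(deg e c) dc.
  by case: (c \notin _).
have c2 : #|\bigcup_(S in pendants) interior S| <= 4 * #|pendants|.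
  apply: card_bigcup_le => S /pendantsP[t [w p1]]; rewrite (interior_pendant p1).
  by case: p1 => _ S5 tS _ _; have := cardsD1 t S; rewrite tS S5; clear; lia.
by clear -lt c1 c2; lia.
Qed.

End Minimal.

(** * The induction and the theorem *)

Lemma graph_well_packed (T : finType) (A : {set T}) (e : rel T) :
  graph A e -> well_packed A e.
Proof.
have [n le] := ubnP #|A|; elim: n A le e => // n IHn A leA e.
have [k] := ubnP #|edges e|; elim: k e => // k IHk e lek gr.
have IHA (A' : {set T}) (e' : rel T) : graph A' e' -> #|A'| < #|A| -> well_packed A' e'.
  by move=> gr' lt; apply: IHn => //; apply: leq_trans lt _.
have IHe (e' : rel T) : graph A e' -> #|edges e'| < #|edges e| -> well_packed A e'.
  by move=> gr' lt; apply: IHk => //; apply: leq_trans lt _.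
have [K0|[S SK]] := set_0Vmem (closed5 A e).
  case: (boolP [exists F, [&& P3_packing e F, cover F \subset A & #|A| <= 4 * #|F|]]).
    move=> /existsP[F /and3P[pF cF leF]]; exists #|F|; first by exists F.
    by apply: leq_trans leF _; apply: leq_addr.
  move=> /existsP no; case: (@minimal_counterexample_false _ A e); split=> //.
    by move=> S SA S5 cS; have := in_set0 S; rewrite -K0 inE SA S5 cS.
  move=> f [F [pF cF fF]]; rewrite ltnNge; apply/negP => leF; apply: no; exists F.
  by rewrite pF cF; apply: leq_trans leF _; rewrite leq_mul2l.
(* A closed 5-set is split off: one path and its own allowance pay for its vertices, [5 = 4 + 1]. *)
move: (SK); rewrite inE => /and3P[SA /eqP S5 cS].
have S0 : S != set0 by rewrite -card_gt0 S5.
have pS := closed_P3 gr SA S0 cS.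
have [sy _ _ _] := gr; move/closed_setP: cS => cS.
have gr' : graph (A :\: S) (avoid e S).
  by apply: (avoid_graph gr) => q x qS xS qx; rewrite (cS q x) in xS.
have QA' : #|A :\: S| + #|S| = #|A|.
  by have := cardsID S A; rewrite (setIidPr SA) addnC.
have [|f pf lef] := IHA _ _ gr'; first by clear -QA' S5; lia.
exists (1 + f).
  rewrite -(setID A S) (setIidPr SA); apply: packsU => //.
    by rewrite -setI_eq0 setIDA setDIl setDv set0I.
  by apply: packs_subrel pf => x y _ _ /and3P[].
have : #|closed5 (A :\: S) (avoid e S)| < #|closed5 A e|.
  apply: proper_card; apply/properP; split; last first.
    exists S => //; rewrite inE; apply/negP => /and3P[/subsetP sub _ _].
    by have /set0Pn[x xS] := S0; have := sub x xS; rewrite inE xS.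
  apply/subsetP => S'; rewrite !inE => /and3P[/subsetP SA' -> /closed_setP cS'] /=.
  apply/andP; split; first by apply/subsetP => x /SA'/setDP[].
  apply/closed_setP => x y xS' xy; apply: (cS' x) => //.
  have /setDP[_ xS] := SA' x xS'; rewrite /avoid xy xS /=.
  by apply: contra xS => yS; apply: (cS y); rewrite // sy.
by clear -lef QA' S5; lia.
Qed.

Lemma closed_component (T : finType) (e : rel T) x : closed_set e (component e x).
Proof.
apply/closed_setP => y z; rewrite !inE => xy yz.
by apply: connect_trans xy (connect1 yz).
Qed.

Lemma component_subset (T : finType) (e : rel T) (S : {set T}) x :
  closed_set e S -> x \in S -> component e x \subset S.
Proof.
move=> /closed_setP cS xS; apply/subsetP => y; rewrite inE => /connectP[p].
elim: p x xS => [|z p IH] x xS /= => [_ ->//|/andP[xz]]; apply: IH; exact: cS xz.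
Qed.

Theorem theorem1p6 (T : finType) (e : rel T) :
  simple_graph e ->
  in_Grs e 2 3 ->
  (forall x : T, #|component e x| != 5) ->
  #|T| <= 4 * lambda e.
Proof.
move=> [sy ir] dG no5.
have gr : graph [set: T] e by split=> // *; rewrite ?inE.
have [f pf] := graph_well_packed gr.
suff -> : closed5 [set: T] e = set0.
  rewrite cards0 addn0 cardsT => le; apply: leq_trans le _.
  by rewrite leq_mul2l (packs_lambda pf).
(* A closed 5-set is a component: otherwise the component of one of its vertices and the remainder
   would have at least three vertices each. *)
apply/setP => S; rewrite in_set0 inE; apply/negP => /and3P[_ /eqP S5 cS].
have /set0Pn[x xS] : S != set0 by rewrite -card_gt0 S5.
have C0 : component e x != set0 by apply/set0Pn; exists x; rewrite inE connect0.
have C3 := closed_ge3 gr (subsetT _) C0 (closed_component e x).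
have sub := component_subset cS xS.
have [D0|D0] := eqVneq (S :\: component e x) set0.
  case/negP: (no5 x); rewrite -S5 eqn_leq subset_leq_card //=.
  by apply: subset_leq_card; rewrite -setD_eq0 D0.
have := closed_ge3 gr (subsetT _) D0 (closed_setD gr cS (closed_component e x)).
by have := cardsID (component e x) S; rewrite (setIidPr sub) S5; clear -C3; lia.
Qed.
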